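(* Let $\mathcal{E}\in\mathfrak{F}$ be an environment on $\mathbb{R}^d$ satisfying 1-dependence, uniformly bounded local intensity, coverage and essential connectedness (all defined in the context), let $X^{\mathsf s}$ be the associated Cox point process with intensity $\lambda\mathcal{E}$, and let $\lambda_c$ be the critical intensity of the associated Cox percolation model. Then $$0<\lambda_c<\infty.$$
   Context: **Environments.** Fix a dimension $d\ge1$, a scale $M\ge 1$ and a scale $b>0$ such that $b^{-1}$ is an integer exceeding $2dM$. For $x\in b\mathbb{Z}^d$ put $Q(x;b,M):=Mx+[0,Mb]^d$. A random Borel measure $\mathcal{E}$ on $\mathbb{R}^d$ is in the class $\mathfrak{F}$ if $\mathcal{E}(\cdot)=\sum_{x\in b\mathbb{Z}^d}\mathcal{E}_x(\cdot;Y)$ with $\mathcal{E}_x(\cdot;Y)=\mathcal{U}_x(Y)\,\mathcal{Q}_x(\cdot;Y)$, where: (a) $Y=\{Y_z\}_{z\in\mathbb{Z}^d}$ is an iid family of random elements of some measurable space; (b) $\mathcal{U}_x=\mathcal{U}_x(Y)$ is a random variable with values in $[0,\infty)$; (c) $\mathcal{Q}_x(\cdot;Y)$ is a random probability measure on $Q(x;b,M)$; (d) translation covariance: for $z_0\in\mathbb{Z}^d$ let $(\tau_{z_0}Y)_z:=Y_{z+z_0}$; then for all $x\in b\mathbb{Z}^d$, $z_0\in\mathbb{Z}^d$, $\mathcal{U}_{x+z_0}(Y)=\mathcal{U}_x(\tau_{z_0}Y)$ and $\mathcal{Q}_{x+z_0}(\cdot;Y)$ is the translate by $Mz_0$ of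 $\mathcal{Q}_x(\cdot;\tau_{z_0}Y)$. **Cox process.** Fix a bimeasurable bijection $\Gamma:[0,Mb]^d\to[0,1]$. Let $\Phi_x(\cdot)=\Phi_x(\cdot;Y)$ be the cumulative distribution function of the push-forward of $\mathcal{Q}_x(\cdot;Y)$ under $y\mapsto\Gamma(y-Mx)$, and $\Phi_x^{-1}(v):=\inf\{y\ge0:\Phi_x(y)\ge v\}$. For $\lambda>0$ let $V=\{V_x\}_{x\in b\mathbb{Z}^d}$, $V_x=\{(V_{x,i},U_{x,i})\}_{i\ge1}$, be iid homogeneous Poisson point processes on $[0,1]\times[0,\infty)$ with intensity $\lambda$, independent of $Y$. Set $$X^{\mathsf s}:=\bigcup_{x\in b\mathbb{Z}^d}\big\{Mx+\Gamma^{-1}(\Phi_x^{-1}(V_{x,i};Y)) : U_{x,i}\le\mathcal{U}_x(Y)\big\}.$$ This is a Cox point process with intensity measure $\lambda\mathcal{E}$; $\mathbb{P}_\lambda$ denotes its law (annealed over $Y$ and $V$). **Conditions on $\mathcal{E}$.** For $z\in\mathbb{Z}^d$ put $I_b(z):=b\mathbb{Z}^d\cap(z+[0,1)^d)$, $I_b^+(z):=b\mathbb{Z}^d\cap(z+[-1,2)^d)$, $I_b^{++}(z):=b\mathbb{Z}^d\cap(z+[-2,3)^d)$, $I^+(z):=z+\{-1,0,1\}^d$. (i) *1-dependence*: for all $z\in\mathbb{Z}^d$ and $x\in I_b(z)$, $\mathcal{E}_x(\{Y_{z'}\}_{z'\in\mathbb{Z}^d})=\mathcal{E}_x(\{Y'_{z'}\}_{z'\in\mathbb{Z}^d})$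 whenever $Y_{z''}=Y'_{z''}$ for every $z''\in I^+(z)$. (ii) *Uniformly bounded local intensity*: there is $\rho>0$ with $\mathcal{U}_x\le\rho$ for every $x\in b\mathbb{Z}^d$. (iii) *Coverage*: a site $x\in b\mathbb{Z}^d$ is non-empty if $\mathcal{U}_x(Y)>0$, and $z\in\mathbb{Z}^d$ is non-empty if some $x\in I_b(z)$ is non-empty. Let $q_0(d)\in[0,1]$ be a constant such that any 6-dependent site percolation model on $\mathbb{Z}^d$ with marginal probability at least $q_0(d)$ percolates (such a constant exists by Liggett–Schonmann–Stacey). Then $\mathbb{P}(o\in\mathbb{Z}^d\text{ is non-empty})>q_0(d)$, where $o$ is the origin. (iv) *Essential connectedness*: $x,x'\in b\mathbb{Z}^d$ are adjacent if their $\ell_\infty$-distance is $b$; for $\eta>0$, $x$ is $\eta$-supported if $\mathcal{U}_x\ge\eta$. There exists $\eta>0$ such that with probability 1, for all $z\in\mathbb{Z}^d$, any non-empty $x,x'\in I_b^+(z)$ are connected by a chain of adjacent $\eta$-supported sites in $I_b^{++}(z)$; that is, there are $k\ge0$ and $x=x_0,x_1,\dots,x_k=x'$ in $I_b^{++}(z)$ with consecutive sites adjacent and $x_1,\dots,x_{k-1}$ $\eta$-supported. **Percolation.** For $A,B\subset\mathbb{R}^d$, $\{A\leftrightsquigarrow B\text{ in }X^{\mathsf s}\}$ is the event that there is a path between $A$ and $B$ in $\bigcup_{y\in X^{\mathsf s}}(y+B(1/2))$, where $B(r)$ is the open Euclidean ball of radius $r$ centred at the origin. Put $\Lambda_r:=[-r,r]^d$,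 $\partial\Lambda_n:=\Lambda_{n-M}\setminus\Lambda_{n-2M}$, $\theta(\lambda):=\lim_{n\to\infty}\mathbb{P}_\lambda(\Lambda_{3M}\leftrightsquigarrow\partial\Lambda_n\text{ in }X^{\mathsf s})$, and $\lambda_c:=\inf\{\lambda>0:\theta(\lambda)>0\}$. *)

(* Defs.v *)
From HB Require Import structures.
From mathcomp Require Import all_boot all_order all_algebra.
From mathcomp Require Import all_classical all_reals all_analysis.
From mathcomp Require Import measurable_realfun.

Set Implicit Arguments.
Unset Strict Implicit.
Unset Printing Implicit Defensive.

Import Order.TTheory GRing.Theory Num.Theory.
Import numFieldNormedType.Exports.

Local Open Scope classical_set_scope.
Local Open Scope ring_scope.

Notation Zlat d := 'rV[int]_d.

Section independence.
Context {R : realType} {dW : measure_display} {W : measurableType dW}.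
Variable P : probability W R.

Definition sigma_of {dT : measure_display} {T : measurableType dT}
    (X : W -> T) : set (set W) :=
  preimage_set_system setT X measurable.

Definition independent (F G : set (set W)) : Prop :=
  forall A B, F A -> G B -> P (A `&` B) = (P A * P B)%E.

Definition mutually_independent (I : eqType) (F : I -> set (set W)) : Prop :=
  forall (J : seq I) (A : I -> set W), uniq J ->
    (forall i, i \in J -> F i (A i)) ->
    P (\big[setI/setT]_(i <- J) A i) = (\prod_(i <- J) P (A i))%E.

Definition iid {I : eqType} {dT : measure_display} {T : measurableType dT}
    (X : I -> W -> T) : Prop :=
  [/\ forall i, measurable_fun setT (X i),
      mutually_independent (fun i => sigma_of (X i)) &
      forall i j B, measurable B -> P (X i @^-1` B) = P (X j @^-1` B)].

End independence.

Section site_percolation.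
Context {d : nat}.

Definition linf_dist (u v : Zlat d) : nat :=
  (\max_(i < d) `|u ord0 i - v ord0 i|)%N.

Definition nearest_neighbour (u v : Zlat d) : bool :=
  (\sum_(i < d) `|u ord0 i - v ord0 i| == 1)%N.

Definition open_cluster (omega : Zlat d -> bool) (u : Zlat d) : set (Zlat d) :=
  [set v | exists s : seq (Zlat d),
    [/\ all omega (u :: s), path nearest_neighbour u s & last u s = v]].

Context {R : realType} {dW : measure_display} {W : measurableType dW}.
Variables (P : probability W R) (eta : Zlat d -> W -> bool).

(* Distances between sets of sites are measured in the sup norm. *)
Definition finitely_dependent (k : nat) : Prop :=
  forall A B : set (Zlat d),
    (forall u v, A u -> B v -> (k < linf_dist u v)%N) ->
    independent P <<s \bigcup_(u in A) sigma_of (eta u) >>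
                  <<s \bigcup_(v in B) sigma_of (eta v) >>.

(* For finitely dependent fields this event has probability 0 or 1, so that
   positive probability amounts to almost sure percolation. *)
Definition percolates : Prop :=
  (0 < P [set w | exists u, infinite_set (open_cluster (eta ^~ w) u)])%E.

End site_percolation.

Definition dependent_percolation_bound (R : realType) (d k : nat) (q : R)
    : Prop :=
  forall (dW : measure_display) (W : measurableType dW) (P : probability W R)
    (eta : Zlat d -> W -> bool),
    (forall z, measurable_fun setT (eta z)) ->
    finitely_dependent P eta k ->
    (forall z, (q%:E <= P [set w | eta z w])%E) ->
    percolates P eta.

(* R^d with its Borel sigma-algebra; the norm [`|_|] of ['rV[R]_d] is the
   sup norm, so the Euclidean distance is defined separately. *)
Notation euclid R d := (g_sigma_algebraType (@open 'rV[R]_d)).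

Definition euclid_dist {R : realType} {d : nat} (p q : 'rV[R]_d) : R :=
  Num.sqrt (\sum_(i < d) (p ord0 i - q ord0 i) ^+ 2).

Definition box {R : realType} {d : nat} (r : R) : set 'rV[R]_d :=
  [set p | forall i, - r <= p ord0 i <= r].

Definition coordinate_system (d : nat) {dS : measure_display}
    (S : measurableType dS) : set (set (Zlat d -> S)) :=
  \bigcup_z preimage_set_system setT (fun y => y z) measurable.

(* Configurations y = (y_z)_z with the product sigma-algebra. *)
Notation config d S := (g_sigma_algebraType (@coordinate_system d _ S)).

Definition shift_config {d : nat} {T : Type} (z0 : Zlat d)
    (y : Zlat d -> T) : Zlat d -> T := fun z => y (z + z0).

Record bimeasurable_bijection {d1 d2 : measure_display}
    {T1 : measurableType d1} {T2 : measurableType d2}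
    (D1 : set T1) (D2 : set T2) (f : T1 -> T2) (g : T2 -> T1) : Prop := {
  bb_fun : set_fun D1 D2 f;
  bb_inv_fun : set_fun D2 D1 g;
  bb_funK : {in D1, cancel f g};
  bb_invK : {in D2, cancel g f};
  bb_fun_measurable : measurable_fun D1 f;
  bb_inv_measurable : measurable_fun D2 g
}.

Section poisson_process.
Context {R : realType} {dW : measure_display} {W : measurableType dW}.
Variable P : probability W R.

Definition strip : set (R * R) := `[0, 1] `*` `[0, +oo[.

Definition point_count (X : nat -> W -> R * R) (A : set (R * R)) (w : W)
    : \bar R :=
  (\sum_(0 <= i <oo) \d_(X i w) A)%E.

Record poisson_process (lam : R) (X : nat -> W -> R * R) : Prop := {
  pp_measurable : forall i, measurable_fun setT (X i);
  pp_strip : forall i w, strip (X i w);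
  pp_law : forall (A : set (R * R)) (n : nat),
    measurable A -> A `<=` strip ->
    ((lebesgue_measure \x lebesgue_measure) A < +oo)%E ->
    let m := lam * fine ((lebesgue_measure \x lebesgue_measure)%E A) in
    P [set w | point_count X A w = n%:R%:E] =
      (expR (- m) * m ^+ n / n`!%:R)%:E;
  pp_indep : forall A : nat -> set (R * R),
    (forall j, measurable (A j)) -> trivIset setT A ->
    mutually_independent P (fun j => sigma_of (point_count X (A j)))
}.

(* The sigma-algebra generated by the point process, i.e. by its counts;
   it does not see the order in which the points are enumerated. *)
Definition sigma_process (X : nat -> W -> R * R) : set (set W) :=
  <<s \bigcup_(A in measurable) sigma_of (point_count X A) >>.

Record poisson_family {d : nat} {dS : measure_display}
    {S : measurableType dS} (Y : Zlat d -> W -> S)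
    (lam : R) (V : Zlat d -> nat -> W -> R * R) : Prop := {
  pf_process : forall k, poisson_process lam (V k);
  pf_indep : mutually_independent P
    (fun o : option (Zlat d) =>
       if o is Some k then sigma_process (V k)
       else sigma_of (fun w => (fun z => Y z w) : config d S))
}.

End poisson_process.

Section environment.
Context {R : realType} {d : nat}.
Variables (M : R) (N : nat).

(* b = 1 / N. The lattice b Z^d is indexed by Z^d: the index k stands for the
   point [site k] = b k, so that the point x + z0 (z0 in Z^d) has index
   k + N z0. *)
Definition mesh : R := N%:R^-1.

Definition site (k : Zlat d) : 'rV[R]_d := mesh *: map_mx intr k.

Definition cube : set 'rV[R]_d :=
  [set q | forall i, 0 <= q ord0 i <= M * mesh].

Definition cell (k : Zlat d) : set 'rV[R]_d :=
  [set p | cube (p - M *: site k)].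

Definition sites_around (l r : R) (z : Zlat d) : set (Zlat d) :=
  [set k | forall i, (z ord0 i)%:~R - l <= site k ord0 i
                     < (z ord0 i)%:~R + r].

Definition Ib : Zlat d -> set (Zlat d) := sites_around 0 1.
Definition Ib1 : Zlat d -> set (Zlat d) := sites_around 1 2.
Definition Ib2 : Zlat d -> set (Zlat d) := sites_around 2 3.

Definition adjacent (k k' : Zlat d) : Prop := `|site k - site k'| = mesh.

Context {dS : measure_display} {S : measurableType dS}.

(* An element of the class is given by its decomposition; the random measure
   itself is [env_measure] below, evaluated at the configuration Y. *)
Record environment := Environment {
  env_U : Zlat d -> config d S -> R;
  env_Q : Zlat d -> R.-pker config d S ~> euclid R d;
  env_U_measurable : forall k, measurable_fun setT (env_U k);
  env_U_ge0 : forall k y, 0 <= env_U k y;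
  env_Q_cell : forall k y, env_Q k y (cell k) = 1%E;
  env_U_shift : forall k z0 y,
    env_U (k + z0 *+ N) y = env_U k (shift_config z0 y);
  env_Q_shift : forall k z0 y (A : set (euclid R d)), measurable A ->
    env_Q (k + z0 *+ N) y A =
    env_Q k (shift_config z0 y)
      [set p | A ((p : 'rV[R]_d) + M *: map_mx intr z0)]
}.

Variable E : environment.

Definition env_local (k : Zlat d) (y : config d S) (A : set (euclid R d))
    : \bar R :=
  ((env_U E k y)%:E * env_Q E k y A)%E.

Definition env_measure (y : config d S) (A : set (euclid R d)) : \bar R :=
  \esum_(k in setT) env_local k y A.

Definition one_dependent : Prop :=
  forall (z k : Zlat d) (y y' : config d S), Ib z k ->
    (forall z' : Zlat d, (linf_dist z z' <= 1)%N -> y z' = y' z') ->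
    forall A, measurable A -> env_local k y A = env_local k y' A.

Definition bounded_local_intensity : Prop :=
  exists2 rho : R, 0 < rho & forall k y, env_U E k y <= rho.

Definition nonempty_site (y : config d S) (k : Zlat d) : Prop :=
  0 < env_U E k y.

Definition nonempty_cell (y : config d S) (z : Zlat d) : Prop :=
  exists2 k, Ib z k & nonempty_site y k.

Definition supported (eta : R) (y : config d S) (k : Zlat d) : Prop :=
  eta <= env_U E k y.

Definition supported_chain (eta : R) (y : config d S) (D : set (Zlat d))
    (k k' : Zlat d) : Prop :=
  exists (n : nat) (c : nat -> Zlat d),
    [/\ c 0%N = k, c n = k',
        forall i, (i <= n)%N -> D (c i),
        forall i, (i < n)%N -> adjacent (c i) (c i.+1) &
        forall i, (0 < i < n)%N -> supported eta y (c i)].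

Context {dW : measure_display} {W : measurableType dW}.
Variables (P : probability W R) (Y : Zlat d -> W -> S).

Definition config_of (w : W) : config d S := fun z => Y z w.

Definition coverage (q0 : R) : Prop :=
  (q0%:E < P [set w | nonempty_cell (config_of w) 0])%E.

Definition essentially_connected : Prop :=
  exists2 eta : R, 0 < eta &
    {ae P, forall w, forall z k k',
      Ib1 z k -> Ib1 z k' ->
      nonempty_site (config_of w) k -> nonempty_site (config_of w) k' ->
      supported_chain eta (config_of w) (Ib2 z) k k'}.

Variables (Gamma : euclid R d -> R) (Gamma_inv : R -> euclid R d).

Definition cell_cdf (k : Zlat d) (y : config d S) (t : R) : R :=
  fine (env_Q E k y
    (cell k `&` [set p | Gamma ((p : 'rV[R]_d) - M *: site k) <= t])).

Definition quantile (F : R -> R) (v : R) : R :=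
  inf [set t | 0 <= t /\ v <= F t].

Definition cox_points (y : config d S) (v : Zlat d -> nat -> R * R)
    : set 'rV[R]_d :=
  [set p | exists k i, (v k i).2 <= env_U E k y /\
     p = M *: site k + Gamma_inv (quantile (cell_cdf k y) (v k i).1)].

Definition connected_in (A B X : set 'rV[R]_d) : Prop :=
  exists gamma : R -> 'rV[R]_d,
    [/\ {within `[0, 1], continuous gamma},
        A (gamma 0), B (gamma 1) &
        forall t, 0 <= t <= 1 ->
          exists2 p, X p & euclid_dist p (gamma t) < 1 / 2].

Definition box_shell (n : nat) : set 'rV[R]_d :=
  box (n%:R - M) `\` box (n%:R - 2 * M).

(* [V lam] realizes the Poisson processes of intensity lam; only its law for
   each fixed lam matters, so no coupling between intensities is assumed. *)
Variable V : R -> Zlat d -> nat -> W -> R * R.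

Definition theta (lam : R) : \bar R :=
  limn (fun n => P [set w | connected_in (box (3 * M)) (box_shell n)
    (cox_points (config_of w) (fun k i => V lam k i w))]).

Definition lambda_c : \bar R :=
  ereal_inf [set lam%:E | lam in [set lam | 0 < lam /\ (0 < theta lam)%E]].

End environment.

(* Main.v *)
Require Import Defs.
From mathcomp Require Import all_boot all_order all_algebra.
From mathcomp Require Import all_classical all_reals all_analysis.
From mathcomp Require Import measurable_realfun.
From mathcomp Require Import ring lra zify.

(* A path in the union of the balls exists exactly when finitely many centres,
   consecutive ones at distance less than 1, link the two sets; crossing events
   are therefore measurable (which matters, as P is unspecified on other sets),
   and by the intermediate value theorem they decrease with n from some rank on,
   so the limit defining theta exists.

   0 < lambda_c: as U <= rho, every point of the process comes from a Poisson
   point of height at most rho. The cells having such a point are iid Bernoulli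
   of parameter at most lam rho, a crossing contains a long walk with bounded
   steps through distinct such cells, and there are at most C D^m walks of
   length m, so theta = 0 once D lam rho <= 1/2.

   lambda_c < +oo: call z good if it is non-empty and if every non-empty site k
   of I_b^{++}(z) has U_k >= delta and a Poisson point of height at most delta.
   The field of good cells is 6-dependent and stationary, and its marginal
   exceeds q0 for delta small and then lam large, so it percolates. By
   stationarity the cluster of the origin is infinite with positive probability,
   and essential connectedness turns it into chains of points at distance less
   than 1 that reach every shell. *)

Set Implicit Arguments.
Unset Strict Implicit.
Unset Printing Implicit Defensive.

Import Order.TTheory GRing.Theory Num.Theory.
Import numFieldNormedType.Exports.

Local Open Scope classical_set_scope.
Local Open Scope ring_scope.

(** * Independence *)

(** Environment and Poisson points are entangled: a point of the site k is kept when its height is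
    at most U_k, a function of Y. Both bounds decouple them by testing heights against a
    deterministic level, rho to bound the kept points from above and delta from below, so that the
    tests are iid bits.

    Essential connectedness gives no lower bound on U at the two ends of a chain, where U may be
    positive but arbitrarily small. Hence delta: the events {0 < U_k < delta} decrease to the empty
    set, so asking for U_k >= delta at the finitely many non-empty sites of a window costs little.
    Of the eta-supported links it is then enough to keep that they are non-empty.

    The families [V lam] are not coupled, so monotonicity of theta is not at hand; the infimum only
    asks for theta <= 0 at every small intensity and for one intensity with theta > 0. *)

Lemma bigcap_finite_support (T : Type) (I : choiceType) (s : seq I)
    (B : I -> set T) :
  (forall i, i \notin s -> B i = setT) ->
  \bigcap_i B i = \big[setI/setT]_(i <- s) B i.
Proof.
move=> Bs; rewrite -(bigcap_seq s B); apply/seteqP; split=> [w Bw i _|w Bw i _].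
  exact: Bw.
by have [/Bw//|/Bs->] := boolP (i \in s).
Qed.

Section independence.
Context {R : realType} {dW : measure_display} {W : measurableType dW}.
Variable P : probability W R.

Lemma independentC (F G : set (set W)) :
  independent P F G -> independent P G F.
Proof. by move=> FG A B GA FB; rewrite setIC muleC; exact: FG. Qed.

(** For a fixed [B] the sets independent of [B] form a Dynkin system, so a generating pi-system
    suffices. One side is generated at a time; the other follows by symmetry. *)
Lemma independent_generated_l (F G : set (set W)) :
  setI_closed F -> F `<=` measurable -> G `<=` measurable ->
  independent P F G -> independent P <<s F >> G.
Proof.
move=> FI mF mG FG A B sA GB.
have msF : <<s F >> `<=` measurable.
  by apply: smallest_sub => //; exact: sigma_algebra_measurable.
suff : <<s F >> `<=` [set A | measurable A /\ P (A `&` B) = (P A * P B)%E].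
  by move=> /(_ _ sA)[].
have mB := mG _ GB.
apply: lambda_system_subset => //.
- apply/dynkin_lambda_system; split => /=.
  + by split=> //; rewrite setTI probability_setT mul1e.
  + move=> C [mC PC]; split; first exact: measurableC.
    have -> : ~` C `&` B = B `\` (C `&` B).
      by rewrite setDIr setDv setU0 setDE setIC.
    rewrite measureD//; [|exact: measurableI|]; last first.
      by rewrite ltey_eq fin_num_measure.
    rewrite setICA setIid [X in (_ - X)%E]PC probability_setC// muleBl ?mul1e//.
    exact: fin_num_measure.
  + move=> C tC /all_and2[mC PC]; split; first exact: bigcupT_measurable.
    rewrite setI_bigcupl measure_bigcup//; last 2 first.
    * by move=> n _; exact: measurableI.
    * apply: trivIset_setIr; exact: tC.
    rewrite measure_bigcup//.
    rewrite -(fineK (fin_num_measure P _ mB)) muleC -nneseriesZl//.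
    by apply: eq_eseriesr => i _; rewrite fineK ?fin_num_measure// muleC; exact: PC.
- by move=> C FC; split; [exact: mF|exact: FG].
Qed.

Lemma independent_generated (F G : set (set W)) :
  setI_closed F -> setI_closed G -> F `<=` measurable -> G `<=` measurable ->
  independent P F G -> independent P <<s F >> <<s G >>.
Proof.
move=> FI GI mF mG FG; apply: independent_generated_l => //.
  by apply: smallest_sub => //; exact: sigma_algebra_measurable.
by apply/independentC/independent_generated_l => //; exact: independentC.
Qed.

Section mutual_independence.
Variables (I : choiceType) (F : I -> set (set W)).
Hypothesis FI : forall i, setI_closed (F i).
Hypothesis FT : forall i, F i setT.
Hypothesis mF : forall i, F i `<=` measurable.
Hypothesis indepF : mutually_independent P F.

(** A pi-system generating the block [J]. The factors form a total family equal to [setT] off [s],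
    and [s] may repeat indices: two meets then intersect index by index over the concatenated
    supports. *)
Definition finite_meets (J : set I) : set (set W) :=
  [set A | exists (s : seq I) (B : I -> set W),
    [/\ {in s, forall i, J i}, forall i, F i (B i),
        forall i, i \notin s -> B i = setT & A = \bigcap_i B i]].

Lemma probability_finite_support (s : seq I) (B : I -> set W) : uniq s ->
  (forall i, F i (B i)) -> (forall i, i \notin s -> B i = setT) ->
  P (\bigcap_i B i) = (\prod_(i <- s) P (B i))%E.
Proof.
by move=> us FB /bigcap_finite_support ->; rewrite indepF.
Qed.

Lemma finite_meets_measurable (J : set I) : finite_meets J `<=` measurable.
Proof.
move=> _ [s [B [_ FB /bigcap_finite_support -> ->]]].
by apply: bigsetI_measurable => i _; exact: (mF (FB i)).
Qed.

Lemma finite_meets_setI (J : set I) : setI_closed (finite_meets J).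
Proof.
move=> _ _ [s [B [sJ FB sB ->]]] [t [C [tJ FC tC ->]]].
exists (s ++ t), (fun i => B i `&` C i); split.
- by move=> i; rewrite mem_cat => /orP[/sJ|/tJ].
- by move=> i; exact: FI.
- move=> i; rewrite mem_cat negb_or => /andP[/sB -> /tC ->].
  by rewrite setIT.
- by rewrite bigcapI.
Qed.

Lemma finite_meets_generated (J : set I) :
  <<s \bigcup_(i in J) F i >> `<=` <<s finite_meets J >>.
Proof.
apply: smallest_sub; first exact: smallest_sigma_algebra.
move=> A [i Ji FA]; apply: sub_sigma_algebra.
exists [:: i], (fun j => if j == i then A else setT); split.
- by move=> j; rewrite inE => /eqP ->.
- by move=> j; case: eqP => [->|].
- by move=> j; rewrite inE => /negbTE ->.
- apply/seteqP; split=> [w Aw j _|w /(_ i Logic.I)]; last by rewrite eqxx.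
  by case: eqP.
Qed.

(** The disjoint supports of two meets concatenate to one duplicate-free list, on which the product
    formula splits; the pi-systems of the two blocks are thus independent. *)
Lemma independent_groups (J K : set I) : J `&` K = set0 ->
  independent P <<s \bigcup_(i in J) F i >> <<s \bigcup_(i in K) F i >>.
Proof.
move=> JK A A' /finite_meets_generated sA /finite_meets_generated sA'.
apply: (independent_generated _ _ _ _ _ sA sA').
- exact: finite_meets_setI.
- exact: finite_meets_setI.
- exact: finite_meets_measurable.
- exact: finite_meets_measurable.
move=> _ _ [s [B [sJ FB sB ->]]] [t [C [tK FC tC ->]]].
have st i : i \in s -> i \notin t.
  by move=> /sJ Ji; apply/negP => /tK Ki; rewrite -[False]/(set0 i) -JK.
rewrite -bigcapI (@probability_finite_support (undup s ++ undup t)).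
- rewrite big_cat /= (@probability_finite_support (undup s) B) ?undup_uniq//; last first.
    by move=> i; rewrite mem_undup; exact: sB.
  rewrite (@probability_finite_support (undup t) C) ?undup_uniq//; last first.
    by move=> i; rewrite mem_undup; exact: tC.
  congr (_ * _)%E; apply: eq_big_seq => i; rewrite mem_undup => ii.
    by rewrite tC ?setIT//; exact: st.
  by rewrite sB ?setTI//; apply/negP => /st; rewrite ii.
- rewrite cat_uniq !undup_uniq andbT; apply/hasPn => i; rewrite !mem_undup.
  by move=> it; apply/negP => /st; rewrite it.
- by move=> i; exact: FI.
- move=> i; rewrite mem_cat !mem_undup negb_or => /andP[/sB -> /tC ->].
  by rewrite setIT.
Qed.

End mutual_independence.

(** The sets on which the two laws agree form a Dynkin system. Stationarity of the noise is deduced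
    from this on boxes and on rectangles. *)
Lemma probability_dynkin {d' : measure_display} {T : measurableType d'}
    (G : set (set T)) (f g : W -> T) :
  measurable_fun setT f -> measurable_fun setT g ->
  @measurable _ T = <<s G >> -> setI_closed G ->
  (forall A, G A -> P (f @^-1` A) = P (g @^-1` A)) ->
  forall A, measurable A -> P (f @^-1` A) = P (g @^-1` A).
Proof.
move=> mf mg mG GI Gfg A mA.
have mpf B : measurable B -> measurable (f @^-1` B).
  by move=> mB; rewrite -[_ @^-1` _]setTI; exact: mf.
have mpg B : measurable B -> measurable (g @^-1` B).
  by move=> mB; rewrite -[_ @^-1` _]setTI; exact: mg.
apply: (@dynkin_induction _ T G (fun A => P (f @^-1` A) = P (g @^-1` A))) => //.
- move=> B mB PB; rewrite -(preimage_setC f) -(preimage_setC g).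
  by rewrite (probability_setC _ (mpf _ mB)) (probability_setC _ (mpg _ mB)) PB.
- move=> B mB tB PB; rewrite (preimage_bigcup _ f) (preimage_bigcup _ g).
  rewrite (measure_bigcup P _ _ (fun i _ => mpf _ (mB i)))//; last first.
    by move=> i j _ _ [w [Bi Bj]]; apply: tB => //; exists (f w).
  rewrite (measure_bigcup P _ _ (fun i _ => mpg _ (mB i)))//; last first.
    by move=> i j _ _ [w [Bi Bj]]; apply: tB => //; exists (g w).
  by apply: eq_eseriesr => i _; exact: PB.
- by rewrite -mG.
Qed.

End independence.

(** * Configurations: the product sigma-algebra and invariance in law under shifts *)

Section configurations.
Context {d : nat} {dS : measure_display} {S : measurableType dS}.

Lemma measurable_to_config {dT : measure_display} {T : measurableType dT}
    (X : T -> config d S) :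
  (forall z, measurable_fun setT (fun t => X t z)) -> measurable_fun setT X.
Proof.
move=> mX; apply: (@measurability _ _ _ (config d S) setT X
  (@coordinate_system d _ S)) => //.
move=> _ [_ [z _ [B mB <-]] <-]; rewrite setTI.
exact: (mX z measurableT B mB).
Qed.

Lemma measurable_coordinate (z : Zlat d) :
  measurable_fun setT (fun y : config d S => y z).
Proof.
move=> _ B mB; apply: sub_sigma_algebra; exists z => //.
by exists B.
Qed.

Lemma measurable_shift_config (u : Zlat d) :
  measurable_fun setT (shift_config u : config d S -> config d S).
Proof. by apply: measurable_to_config => z; exact: measurable_coordinate. Qed.

(** Finite-dimensional boxes: unlike [coordinate_system], this generating class is stable under
    intersection. *)
Definition config_boxes : set (set (config d S)) :=
  [set A | exists (s : seq (Zlat d)) (B : Zlat d -> set S),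
    [/\ forall i, measurable (B i), forall i, i \notin s -> B i = setT &
        A = \bigcap_i [set y | B i (y i)]]].

Lemma config_boxes_setI : setI_closed config_boxes.
Proof.
move=> _ _ [s [B [mB sB ->]]] [t [C [mC tC ->]]].
exists (s ++ t), (fun i => B i `&` C i); split.
- by move=> i; exact: measurableI.
- move=> i; rewrite mem_cat negb_or => /andP[/sB -> /tC ->].
  by rewrite setIT.
- by rewrite -bigcapI.
Qed.

Lemma config_boxes_measurable : config_boxes `<=` measurable.
Proof.
move=> _ [s [B [mB sB ->]]].
rewrite (@bigcap_finite_support _ _ s); last first.
  by move=> i /sB ->.
apply: bigsetI_measurable => i _.
by rewrite -[X in measurable X]setTI; exact: measurable_coordinate.
Qed.

Lemma measurable_configE : @measurable _ (config d S) = <<s config_boxes >>.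
Proof.
apply/seteqP; split.
  apply: smallest_sub; first exact: smallest_sigma_algebra.
  move=> _ [z _ [B mB <-]]; apply: sub_sigma_algebra.
  exists [:: z], (fun i => if i == z then B else setT); split.
  - by move=> i; case: eqP.
  - by move=> i; rewrite inE => /negbTE ->.
  - apply/seteqP; split=> [y [_ By] i _ /=|y /(_ z Logic.I)/=].
      by case: eqP => [->|].
    by rewrite eqxx.
apply: smallest_sub; last exact: config_boxes_measurable.
exact: sigma_algebra_measurable.
Qed.

Context {R : realType} {dW : measure_display} {W : measurableType dW}.
Variable P : probability W R.

Lemma iid_shift_law (X : Zlat d -> W -> S) (u : Zlat d)
    (A : set (config d S)) : iid P X -> measurable A ->
  P [set w | A (shift_config u (config_of X w))] = P [set w | A (config_of X w)].
Proof.
move=> [mX iX lX]; apply: (@probability_dynkin _ _ _ P _ (config d S) config_boxes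
  (shift_config u \o config_of X) (config_of X)).
- by apply: measurable_to_config => z; exact: mX.
- by apply: measurable_to_config => z; exact: mX.
- exact: measurable_configE.
- exact: config_boxes_setI.
move=> _ [s [B [mB sB ->]]].
rewrite !preimage_bigcap !(@bigcap_finite_support _ _ (undup s)); last 2 first.
- by move=> i; rewrite mem_undup => /sB ->.
- by move=> i; rewrite mem_undup => /sB ->.
have us := undup_uniq s.
rewrite (iX _ (fun i => [set w | B i (X i w)])) //; last first.
  by move=> i _; exists (B i) => //; rewrite setTI.
(* Reindexing by [i + u] turns the shifted box into a box for the unshifted coordinates; the two
   products then differ only by the marginal laws, which are equal. *)
have -> : \big[setI/setT]_(i <- undup s)
    ((shift_config u \o config_of X) @^-1` [set y | B i (y i)]) =
  \big[setI/setT]_(i <- [seq i + u | i <- undup s])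
    [set w | B (i - u) (X i w)].
  rewrite big_map; apply: eq_bigr => i _; rewrite addrK.
  by [].
rewrite iX; last 2 first.
- by rewrite map_inj_uniq//; exact: addIr.
- by move=> i _; exists (B (i - u)) => //; rewrite setTI.
rewrite big_map; apply: eq_bigr => i _; rewrite addrK.
exact: lX.
Qed.

End configurations.

(** Two separate shifts are allowed because Y is indexed by cells and the points by sites, N per
    unit length: translating the cells by [u] moves the site indices by [u *+ N]. *)
Lemma joint_shift_law {d : nat} {dS dT dW : measure_display}
    {S : measurableType dS} {T : measurableType dT} {R : realType}
    {W : measurableType dW} (P : probability W R)
    (X : Zlat d -> W -> S) (Z : Zlat d -> W -> T) (u v : Zlat d)
    (A : set (config d S * config d T)) : iid P X -> iid P Z ->
  independent P (sigma_of (config_of X))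
    (sigma_of (config_of Z)) ->
  measurable A ->
  P [set w | A (shift_config u (config_of X w), shift_config v (config_of Z w))] =
  P [set w | A (config_of X w, config_of Z w)].
Proof.
move=> iX iZ XZ.
have mX : measurable_fun setT (config_of X).
  by apply: measurable_to_config => z; case: iX => + _ _; exact.
have mZ : measurable_fun setT (config_of Z).
  by apply: measurable_to_config => z; case: iZ => + _ _; exact.
have mXu : measurable_fun setT (shift_config u \o config_of X : W -> config d S).
  by apply: measurable_to_config => z; case: iX => + _ _; exact.
have mZv : measurable_fun setT (shift_config v \o config_of Z : W -> config d T).
  by apply: measurable_to_config => z; case: iZ => + _ _; exact.
apply: (@probability_dynkin _ _ _ P _ (config d S * config d T)%type
  [set A `*` B | A in measurable & B in measurable]
  (fun w => (shift_config u (config_of X w), shift_config v (config_of Z w)))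
  (fun w => (config_of X w, config_of Z w))).
- exact: measurable_fun_pair.
- exact: measurable_fun_pair.
- exact: measurable_prod_measurableType.
- move=> _ _ [B mB [C mC <-]] [B' mB' [C' mC' <-]].
  exists (B `&` B'); first exact: measurableI.
  exists (C `&` C'); first exact: measurableI.
  by rewrite setXI.
- move=> _ [B mB [C mC <-]].
  rewrite [LHS](XZ [set w | B (shift_config u (config_of X w))]
    [set w | C (shift_config v (config_of Z w))]); last 2 first.
  + exists (shift_config u @^-1` B); last by rewrite setTI.
    by rewrite -[X in measurable X]setTI; exact: measurable_shift_config.
  + exists (shift_config v @^-1` C); last by rewrite setTI.
    by rewrite -[X in measurable X]setTI; exact: measurable_shift_config.
  rewrite [RHS](XZ [set w | B (config_of X w)] [set w | C (config_of Z w)]); last 2 first.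
  + by exists B => //; rewrite setTI.
  + by exists C => //; rewrite setTI.
  by rewrite !iid_shift_law.
Qed.

Lemma sigma_of_measurable {dW dT : measure_display} {W : measurableType dW}
    {T : measurableType dT} (X : W -> T) :
  measurable_fun setT X -> sigma_of X `<=` measurable.
Proof. by move=> mX _ [B mB <-]; exact: mX. Qed.

Lemma sigma_of_setI {dW dT : measure_display} {W : measurableType dW}
    {T : measurableType dT} (X : W -> T) : setI_closed (sigma_of X).
Proof.
move=> _ _ [B mB <-] [C mC <-]; exists (B `&` C); first exact: measurableI.
by rewrite !setTI.
Qed.

Lemma sigma_of_setT {dW dT : measure_display} {W : measurableType dW}
    {T : measurableType dT} (X : W -> T) : sigma_of X setT.
Proof. by exists setT => //; rewrite setTI. Qed.

(** The sets whose preimage lies in the right-hand side form a sigma-algebra containing the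
    coordinate events. This brings events on whole configurations within reach of
    [independent_groups]. *)
Lemma sigma_of_config {dW dS : measure_display} {W : measurableType dW}
    {S : measurableType dS} {d : nat} (X : Zlat d -> W -> S) :
  sigma_of (config_of X) `<=` <<s \bigcup_(z in setT) sigma_of (X z) >>.
Proof.
move=> _ [B mB <-]; rewrite setTI.
pose H := [set A : set (config d S) |
  <<s \bigcup_(z in setT) sigma_of (X z) >> (config_of X @^-1` A)].
suff : <<s @coordinate_system d _ S >> `<=` H by exact.
apply: smallest_sub.
  split => /=.
  - by rewrite /H/= preimage_set0; exact: sigma_algebra0.
  - by move=> A HA; rewrite /H/= setTD -preimage_setC; exact: sigma_algebraC.
  - by move=> A HA; rewrite /H/= preimage_bigcup; exact: sigma_algebra_bigcup.
move=> _ [z _ [A mA <-]]; rewrite /H/= setTI.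
apply: sub_sigma_algebra; exists z => //; exists A => //.
by rewrite setTI.
Qed.

(** * The environment and the Poisson processes as one independent noise *)

Section poisson_noise.
Context {R : realType} {dW : measure_display} {W : measurableType dW}.
Variable P : probability W R.

Lemma measurable_point_count (X : nat -> W -> R * R) (A : set (R * R)) :
  (forall i, measurable_fun setT (X i)) -> measurable A ->
  measurable_fun setT (point_count X A).
Proof.
move=> mX mA; apply: ge0_emeasurable_sum => //.
move=> i _; have -> : (fun w => \d_(X i w) A) = (EFin \o (\1_(X i @^-1` A)) : W -> \bar R).
  by apply/funext => w; rewrite /= diracE indicE.
apply/measurable_EFinP; apply: measurable_indic.
by rewrite -[X in measurable X]setTI; exact: mX.
Qed.

Lemma sigma_process_measurable (X : nat -> W -> R * R) :
  (forall i, measurable_fun setT (X i)) -> sigma_process X `<=` measurable.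
Proof.
move=> mX; apply: smallest_sub; first exact: sigma_algebra_measurable.
by move=> A [B mB]; apply: sigma_of_measurable; exact: measurable_point_count.
Qed.

Context {d : nat} {dS : measure_display} {S : measurableType dS}.
Variables (Y : Zlat d -> W -> S) (lam : R) (V : Zlat d -> nat -> W -> R * R).
Hypotheses (hY : iid P Y) (hV : poisson_family P Y lam V).

(** [poisson_family] treats Y as one block; here the block is split, so that events can be localised
    at single cells and sites. *)
Definition noise (i : Zlat d + Zlat d) : set (set W) :=
  match i with inl z => sigma_of (Y z) | inr k => sigma_process (V k) end.

Lemma noise_measurable i : noise i `<=` measurable.
Proof.
case: i => z /=; first by apply: sigma_of_measurable; case: hY.
by apply: sigma_process_measurable; apply: pp_measurable; apply: pf_process hV z.
Qed.

Lemma noise_setT i : noise i setT.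
Proof.
case: i => z /=; first exact: sigma_of_setT.
by rewrite -setC0; apply: sigma_algebraC; exact: sigma_algebra0.
Qed.

Lemma noise_setI i : setI_closed (noise i).
Proof.
case: i => z /=; first exact: sigma_of_setI.
by move=> A B sA sB; exact: (@measurableI _ (g_sigma_algebraType _) A B sA sB).
Qed.

Lemma noise_independent : mutually_independent P noise.
Proof.
move=> J A uJ FA.
pose Jl := pmap (fun i : Zlat d + Zlat d => if i is inl z then Some z else None) J.
pose Jr := pmap (fun i : Zlat d + Zlat d => if i is inr z then Some z else None) J.
(* The Y-indices are separated from the V-indices: the events on Y meet in a single event of the
   block [None], which then factors since Y is iid. *)
have pJ : perm_eq J (map inl Jl ++ map inr Jr).
  rewrite /Jl /Jr; elim: {uJ FA Jl Jr} J => //= -[z|k] J IH /=.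
    by rewrite perm_cons.
  rewrite perm_sym -(cat1s (inr k) (map inr _)) perm_catCA /= perm_cons.
  by rewrite perm_sym.
have uJ' : uniq (map inl Jl ++ map inr Jr : seq (Zlat d + Zlat d)) by rewrite -(perm_uniq pJ).
move: uJ'; rewrite cat_uniq => /and3P[ul _ ur].
have memJ i : (i \in J) = (i \in (map inl Jl ++ map inr Jr : seq (Zlat d + Zlat d))).
  exact: perm_mem.
rewrite (perm_big _ pJ) [in RHS](perm_big _ pJ) !big_cat/= !big_map.
have FAl z : z \in Jl -> sigma_of (Y z) (A (inl z)).
  by move=> zJ; apply: (FA (inl z)); rewrite memJ mem_cat map_f.
have FAr z : z \in Jr -> sigma_process (V z) (A (inr z)).
  by move=> zJ; apply: (FA (inr z)); rewrite memJ mem_cat map_f ?orbT.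
have := pf_indep hV (J := None :: map Some Jr)
  (A := fun o => if o is Some k then A (inr k) else
     \big[setI/setT]_(i <- Jl) A (inl i)).
rewrite !big_cons !big_map => ->.
- by case: hY => _ iY _; rewrite iY//; exact: map_uniq ul.
- rewrite /= map_inj_uniq; last by move=> ? ? [].
  rewrite (map_uniq ur) andbT; apply/negP => /mapP[]//.
- move=> o; rewrite inE => /predU1P[->{o}|/mapP[k kJ ->]]; last exact: FAr.
  rewrite big_seq; apply: (big_ind (sigma_of (config_of Y))).
  + exact: sigma_of_setT.
  + exact: sigma_of_setI.
  + move=> z /FAl[B mB <-]; exists ((fun y => y z) @^-1` B) => //.
    by rewrite -[X in measurable X]setTI; exact: measurable_coordinate.
Qed.

(** Stated through the count, since [sigma_process] does not see the enumeration of the points. *)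
Definition point_bit (D : set (R * R)) (k : Zlat d) (w : W) : bool :=
  (0 < point_count (V k) D w)%E.

Lemma sigma_process_point_bit (D : set (R * R)) (k : Zlat d) :
  measurable D -> sigma_of (point_bit D k) `<=` sigma_process (V k).
Proof.
move=> mD _ [B mB <-]; rewrite setTI; apply: sub_sigma_algebra.
exists D => //; exists [set x | (0 < x)%E \in B]; last first.
  by rewrite setTI; apply/seteqP; split=> w /=; rewrite inE.
have -> : [set x : \bar R | (0 < x)%E \in B] =
   (fun x : \bar R => (0 < x)%E) @^-1` B by apply/seteqP; split=> w /=; rewrite inE.
have : measurable_fun setT (fun x : \bar R => (0 < x)%E).
  exact: measurable_fun_lte.
by move=> /(_ measurableT _ mB); rewrite setTI.
Qed.

Lemma probability_point_bit (D : set (R * R)) (k : Zlat d) :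
  measurable D -> D `<=` strip ->
  ((lebesgue_measure \x lebesgue_measure) D < +oo)%E ->
  P [set w | point_bit D k w] =
    (1 - expR (- (lam * fine ((lebesgue_measure \x lebesgue_measure)%E D))))%:E.
Proof.
move=> mD Ds Doo.
have pV := pf_process hV k.
have := pp_law pV 0 mD Ds Doo; rewrite /= expr0 fact0 mulr1 divr1 => PD0.
have -> : [set w | point_bit D k w] = ~` [set w | point_count (V k) D w = 0%:E].
  apply/seteqP; split=> w /=; rewrite /point_bit.
    by move=> /[swap] ->; rewrite ltxx.
  move=> /eqP c0; rewrite lt0e c0/=; apply: nneseries_ge0 => *.
  exact: measure_ge0.
rewrite probability_setC; first by rewrite PD0.
rewrite -[X in measurable X]setTI.
exact: (measurable_point_count (pp_measurable pV) mD measurableT (emeasurable_set1 0%E)).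
Qed.

Lemma iid_point_bit (D : set (R * R)) :
  measurable D -> D `<=` strip ->
  ((lebesgue_measure \x lebesgue_measure) D < +oo)%E -> iid P (point_bit D).
Proof.
move=> mD Ds Doo.
have mb k : measurable_fun setT (point_bit D k).
  move=> _ B mB.
  apply: (@sigma_process_measurable (V k)).
    by apply: pp_measurable; apply: (pf_process hV k).
  by apply: sigma_process_point_bit mD _ _; exists B.
split => //.
- move=> J A uJ FA.
  have uJr : uniq (map inr J : seq (Zlat d + Zlat d)).
    by rewrite map_inj_uniq //; move=> ? ? [].
  have := noise_independent (A := fun i => if i is inr k then A k else setT) uJr.
  rewrite !big_map; apply=> _ /mapP[k kJ ->] /=.
  by apply: (sigma_process_point_bit mD); exact: FA.
- move=> i j B _.
  have E k : P [set w | point_bit D k w] = P [set w | point_bit D 0 w].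
    by rewrite !probability_point_bit.
  have mE k : measurable [set w | point_bit D k w].
    by have := mb k measurableT [set true] Logic.I; rewrite setTI.
  have [Bt|Bt] := pselect (B true); have [Bf|Bf] := pselect (B false).
  + have Eb k : point_bit D k @^-1` B = setT.
      by apply/seteqP; split=> w //= _; case: point_bit.
    by rewrite !Eb.
  + have Eb k : point_bit D k @^-1` B = [set w | point_bit D k w].
      by apply/seteqP; split=> w /=; case: point_bit.
    by rewrite !Eb !E.
  + have Eb k : point_bit D k @^-1` B = ~` [set w | point_bit D k w].
      by apply/seteqP; split=> w /=; case: point_bit.
    by rewrite !Eb !(probability_setC _ (mE _)) !E.
  + have Eb k : point_bit D k @^-1` B = set0.
      by apply/seteqP; split=> w //=; case: point_bit.
    by rewrite !Eb.
Qed.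

End poisson_noise.

(** * Paths in unions of balls *)

Section euclid.
Context {R : realType} {d : nat}.
Implicit Types p q x : 'rV[R]_d.

(** Cauchy-Schwarz: the nonnegative sum of the [(B * a i - C * b i) ^+ 2] equals
    [B * (A * B - C ^+ 2)], and the factor [B] is why [B = 0] is treated apart. *)
Lemma sum_mul_sqr_le (a b : 'I_d -> R) :
  (\sum_i a i * b i) ^+ 2 <= (\sum_i a i ^+ 2) * (\sum_i b i ^+ 2).
Proof.
set A := \sum_i a i ^+ 2; set B := \sum_i b i ^+ 2; set C := \sum_i a i * b i.
have B0 : 0 <= B by apply: sumr_ge0 => i _; exact: sqr_ge0.
have [Bz|Bnz] := eqVneq B 0.
  have -> : C = 0.
    apply: big1 => i _.
    move: (Bz) => /eqP; rewrite psumr_eq0; last by move=> ? _; exact: sqr_ge0.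
    move=> /allP /(_ i (mem_index_enum i)) /=; by rewrite sqrf_eq0 => /eqP ->; rewrite mulr0.
  by rewrite expr0n Bz mulr0.
have : 0 <= \sum_i (B * a i - C * b i) ^+ 2.
  by apply: sumr_ge0 => i _; exact: sqr_ge0.
have -> : \sum_i (B * a i - C * b i) ^+ 2 = B * (A * B - C ^+ 2).
  transitivity (\sum_i (B ^+ 2 * a i ^+ 2 - 2 * B * C * (a i * b i) + C ^+ 2 * b i ^+ 2)).
    by apply: eq_bigr => i _; ring.
  rewrite big_split sumrB /= -!mulr_sumr -/A -/B -/C.
  ring.
by rewrite pmulr_rge0 ?subr_ge0// lt0r Bnz.
Qed.

Lemma euclid_dist_triangle p q x :
  euclid_dist p q <= euclid_dist p x + euclid_dist x q.
Proof.
rewrite /euclid_dist.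
pose a i := p ord0 i - x ord0 i; pose b i := x ord0 i - q ord0 i.
have -> : \sum_i (p ord0 i - q ord0 i) ^+ 2 =
  \sum_i a i ^+ 2 + \sum_i b i ^+ 2 + 2 * \sum_i a i * b i.
  rewrite mulr_sumr -!big_split /=; apply: eq_bigr => i _; rewrite /a /b; ring.
rewrite -/(\sum_i a i ^+ 2) -/(\sum_i b i ^+ 2).
have := sum_mul_sqr_le a b.
set A := \sum_i a i ^+ 2; set B := \sum_i b i ^+ 2; set C := \sum_i a i * b i.
have A0 : 0 <= A by apply: sumr_ge0 => i _; exact: sqr_ge0.
have B0 : 0 <= B by apply: sumr_ge0 => i _; exact: sqr_ge0.
move=> CAB.
have CsAB : C <= Num.sqrt A * Num.sqrt B.
  rewrite -sqrtrM//; apply: le_trans (ler_norm C) _.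
  by rewrite -sqrtr_sqr ler_wsqrtr.
rewrite -(@ler_pXn2r _ 2) ?nnegrE ?addr_ge0 ?sqrtr_ge0//.
rewrite sqr_sqrtr; last first.
  have -> : A + B + 2 * C = \sum_i (a i + b i) ^+ 2.
    rewrite /A /B /C mulr_sumr -!big_split /=; apply: eq_bigr => i _; ring.
  by apply: sumr_ge0 => i _; exact: sqr_ge0.
rewrite sqrrD !sqr_sqrtr// -mulr_natl; lra.
Qed.

Lemma euclid_distC p q : euclid_dist p q = euclid_dist q p.
Proof.
by congr Num.sqrt; apply: eq_bigr => i _; rewrite -sqrrN opprB.
Qed.

Lemma euclid_dist_coord p q i : `|p ord0 i - q ord0 i| <= euclid_dist p q.
Proof.
rewrite -sqrtr_sqr ler_wsqrtr// (bigD1 i)//= lerDl.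
by apply: sumr_ge0 => j _; exact: sqr_ge0.
Qed.

Lemma euclid_dist_le p q (c : R) : 0 <= c ->
  (forall i, `|p ord0 i - q ord0 i| <= c) -> euclid_dist p q <= d%:R * c.
Proof.
move=> c0 pqc; rewrite /euclid_dist.
have -> : d%:R * c = Num.sqrt ((d%:R * c) ^+ 2).
  by rewrite sqrtr_sqr ger0_norm// mulr_ge0.
apply: ler_wsqrtr; apply: (@le_trans _ _ (\sum_(i < d) c ^+ 2)).
  apply: ler_sum => i _; rewrite -real_normK ?num_real//.
  by rewrite lerXn2r ?nnegrE ?pqc.
rewrite sumr_const card_ord -[c ^+ 2 *+ d]mulr_natl exprMn ler_wpM2r ?sqr_ge0//.
by rewrite -natrX ler_nat; case: (d) => // n; rewrite -[leqLHS]expn1 leq_pexp2l.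
Qed.

Lemma euclid_dist_segment p q (t : R) :
  euclid_dist p (p + t *: (q - p)) = `|t| * euclid_dist p q.
Proof.
rewrite -sqrtr_sqr -sqrtrM ?sqr_ge0// mulr_sumr; congr Num.sqrt.
by apply: eq_bigr => i _; rewrite !mxE; ring.
Qed.

Lemma open_euclid_ball p (r : R) : open [set x | euclid_dist p x < r].
Proof.
rewrite openE => x /= pxr; apply/nbhs_ballP.
(* Neighbourhoods are sup-norm balls, and the Euclidean distance is at most [d] times the sup
   distance; [d.+1] keeps the divisor positive and the final inequality strict. *)
exists ((r - euclid_dist p x) / d.+1%:R) => /=.
  by rewrite divr_gt0// subr_gt0.
move=> y [_ xy] /=; apply: le_lt_trans (euclid_dist_triangle p y x) _.
rewrite -ltrBrDl; set e := r - _; have e0 : 0 < e by rewrite subr_gt0.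
apply: (@le_lt_trans _ _ (d%:R * (e / d.+1%:R))).
  apply: euclid_dist_le; first by rewrite divr_ge0// ltW.
  by move=> i; apply/ltW; exact: xy.
rewrite mulrCA -[ltRHS]mulr1 ltr_pM2l// ltr_pdivrMr ?mul1r ?ltr_nat//.
Qed.

Lemma mx_norm_le p (c : R) : 0 <= c ->
  (`|p| <= c) <-> (forall i, `|p ord0 i| <= c).
Proof.
move=> c0; rewrite /Num.Def.normr/= mx_normrE; split=> [pc i|pc].
  apply: le_trans pc.
  exact: (@le_bigmax _ _ _ 0 (fun i : 'I_1 * 'I_d => `|p i.1 i.2|) (ord0, i)).
apply: bigmax_le => // -[i j] _ /=; rewrite ord1; exact: pc.
Qed.

Lemma boxP (r : R) p : 0 <= r -> box r p <-> `|p| <= r.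
Proof.
move=> r0; rewrite mx_norm_le//; split=> h i; first by rewrite ler_norml; exact: h.
by rewrite -ler_norml; exact: h.
Qed.

End euclid.

Section paths.
Context {R : realType} {d : nat}.
Implicit Types (A B U X : set 'rV[R]_d) (a b c p : 'rV[R]_d).

(** Continuity is asked on all of R, so that paths can be reparametrised and concatenated without
    subspace topologies. *)
Definition joined U a b : Prop := exists g : R -> 'rV[R]_d,
  [/\ continuous g, g 0 = a, g 1 = b & forall t, 0 <= t <= 1 -> U (g t)].

Lemma joined_segment U a b :
  (forall t, 0 <= t <= 1 -> U (a + t *: (b - a))) -> joined U a b.
Proof.
move=> Uab; exists (fun t => a + t *: (b - a)); split => //.
- move=> t; apply: cvgD; first exact: cvg_cst.
  by apply: cvgZr_tmp; exact: cvg_id.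
- by rewrite scale0r addr0.
- by rewrite scale1r addrC subrK.
Qed.

(** At every time one of [g (l t)] and [h (r t)] equals [b], so their sum minus [b] is the
    concatenation, visibly continuous without a gluing argument. *)
Lemma joined_trans U a b c : joined U a b -> joined U b c -> joined U a c.
Proof.
move=> [g [cg g0 g1 Ug]] [h [ch h0 h1 Uh]].
(* [l] and [r] are min (2 t) 1 and max (2 t - 1) 0. *)
pose m (t : R) := 2 * t - 1.
pose l (t : R) := 2^-1 * (m t - `|m t|) + 1; pose r (t : R) := 2^-1 * (m t + `|m t|).
have cm : continuous m.
  by move=> t; apply: cvgB; [exact: mulrl_continuous|exact: cvg_cst].
have cnm : continuous (fun t => `|m t|).
  move=> t; apply: (@continuous_comp _ _ _ m Num.norm); first exact: cm.
  exact: norm_continuous.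
have cl : continuous l.
  move=> t; apply: cvgD; last exact: cvg_cst.
  by apply: cvgMl_tmp; apply: cvgB; [exact: cm|exact: cnm].
have cr : continuous r.
  by move=> t; apply: cvgMl_tmp; apply: cvgD; [exact: cm|exact: cnm].
have low t : t <= 1 / 2 -> g (l t) + h (r t) - b = g (2 * t).
  move=> t2; have mt : `|m t| = - m t by rewrite ler0_norm// /m; lra.
  have -> : r t = 0 by rewrite /r mt; lra.
  by rewrite h0 addrK; congr g; rewrite /l mt /m; lra.
have high t : 1 / 2 <= t -> g (l t) + h (r t) - b = h (2 * t - 1).
  move=> t2; have mt : `|m t| = m t by rewrite ger0_norm// /m; lra.
  have -> : l t = 1 by rewrite /l mt; lra.
  by rewrite g1 addrC addrA addNr add0r; congr h; rewrite /r mt /m; lra.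
exists (fun t => g (l t) + h (r t) - b); split => //.
- move=> t; apply: cvgB; last exact: cvg_cst.
  apply: cvgD.
    by apply: (@continuous_comp _ _ _ l g); [exact: cl|exact: cg].
  by apply: (@continuous_comp _ _ _ r h); [exact: cr|exact: ch].
- by rewrite low ?mulr0//; lra.
- by rewrite high//; [rewrite -h1; congr h; lra|lra].
- move=> t t01; have [t2|t2] := leP t (1 / 2).
    by rewrite low//; apply: Ug; lra.
  by rewrite high ?ltW//; apply: Uh; lra.
Qed.

Definition covered X : set 'rV[R]_d :=
  [set x | exists2 p, X p & euclid_dist p x < 1 / 2].

Lemma joined_connected A B X a b : A a -> B b -> joined (covered X) a b ->
  connected_in A B X.
Proof.
move=> Aa Bb [g [cg ga gb Ug]]; exists g; split; rewrite ?ga ?gb//.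
exact: continuous_subspaceT.
Qed.

Lemma joined_sym U a b : joined U a b -> joined U b a.
Proof.
move=> [g [cg g0 g1 Ug]]; exists (fun t => g (1 - t)); split.
- move=> t; apply: (@continuous_comp _ _ _ (fun t : R => 1 - t) g); last exact: cg.
  by apply: cvgB; [exact: cvg_cst|exact: cvg_id].
- by rewrite subr0.
- by rewrite subrr.
- by move=> t t01; apply: Ug; lra.
Qed.

Lemma joined_center X p x : X p -> euclid_dist p x < 1 / 2 ->
  joined (covered X) p x.
Proof.
move=> Xp px; apply: joined_segment => t t01; exists p => //.
rewrite euclid_dist_segment ger0_norm; last by lra.
apply: le_lt_trans px; rewrite ler_piMl//; [exact: sqrtr_ge0|lra].
Qed.

(** The midpoint lies in both balls. *)
Lemma joined_centers X p q : X p -> X q -> euclid_dist p q < 1 ->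
  joined (covered X) p q.
Proof.
move=> Xp Xq pq; pose m := p + (1 / 2) *: (q - p).
have pm : euclid_dist p m < 1 / 2.
  by rewrite euclid_dist_segment ger0_norm; lra.
have qm : euclid_dist q m < 1 / 2.
  have -> : m = q + (1 / 2) *: (p - q).
    by apply/rowP => i; rewrite !mxE; lra.
  by rewrite euclid_dist_segment ger0_norm ?(euclid_distC q); lra.
apply: (@joined_trans _ _ m); first exact: joined_center.
by apply: joined_sym; exact: joined_center.
Qed.

Definition near_set A p : Prop := exists2 a, A a & euclid_dist p a < 1 / 2.

Context {J : eqType} (pt : J -> 'rV[R]_d) (act : J -> Prop).

(** Chains run over indices, so that for countable [J] a connection is one of countably many
    conditions, each on finitely many points. *)
Definition point_chain A B (j : J) (s : seq J) : Prop :=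
  [/\ {in j :: s, forall i, act i},
      path (fun i k => euclid_dist (pt i) (pt k) < 1) j s,
      near_set A (pt j) & near_set B (pt (last j s))].

Let X := [set p | exists2 j, act j & p = pt j].

Lemma point_chain_joined A B j s : point_chain A B j s ->
  exists a b, [/\ A a, B b & joined (covered X) a b].
Proof.
move=> [actjs pjs [a Aa ja] [b Bb jb]]; exists a, b; split => //.
have Xj i : i \in j :: s -> X (pt i) by move=> /actjs acti; exists i.
apply: (@joined_trans _ _ (pt j)).
  apply: joined_sym; apply: joined_center => //; apply: Xj.
  exact: mem_head.
apply: (@joined_trans _ _ (pt (last j s))); last first.
  by apply: joined_center => //; apply: Xj; exact: mem_last.
elim: s j {actjs jb ja} pjs Xj => [|k s IH] j /=.
  move=> _ Xj; apply: joined_center; first by apply: Xj; exact: mem_head.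
  rewrite /euclid_dist big1 => [|i _]; last by rewrite subrr expr0n.
  by rewrite sqrtr0 divr_gt0.
move=> /andP[jk ks] Xj; apply: (@joined_trans _ _ (pt k)).
  apply: joined_centers => //; apply: Xj; rewrite !inE eqxx ?orbT//.
by apply: IH => // i iks; apply: Xj; rewrite inE iks orbT.
Qed.

Lemma connected_point_chain A B : connected_in A B X ->
  exists j s, point_chain A B j s.
Proof.
move=> [g [cg Ag Bg gX]].
(* The balls around the centres reachable from [A] and the balls around the
   other ones are disjoint open sets covering the connected set [g @` [0, 1]]. *)
pose reach j := exists j0 s, [/\ {in j0 :: s, forall i, act i},
  path (fun i k => euclid_dist (pt i) (pt k) < 1) j0 s,
  near_set A (pt j0) & last j0 s = j].
pose D := \bigcup_(j in reach) [set x | euclid_dist (pt j) x < 1 / 2].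
pose D' := \bigcup_(j in [set j | act j /\ ~ reach j]) [set x | euclid_dist (pt j) x < 1 / 2].
have oD : open D by apply: bigcup_open => j _; exact: open_euclid_ball.
have oD' : open D' by apply: bigcup_open => j _; exact: open_euclid_ball.
pose K := g @` `[0, 1].
have cK : connected K.
  apply: connected_continuous_connected => //; exact: segment_connected.
have KX x : K x -> exists2 j, act j & euclid_dist (pt j) x < 1 / 2.
  move=> [t /=]; rewrite in_itv /= => t01 <-.
  by have [_ [j aj ->] jt] := gX t t01; exists j.
(* A common point [x] would put [k] at distance less than 1 from [j], and the chain to [j] could be
   extended to [k]. *)
have DD' x : D x -> ~ D' x.
  move=> [j [j0 [s [a0 p0 A0 l0]]] jx] [k [ak nk] kx]; apply: nk.
  exists j0, (rcons s k); split => //.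
  - move=> i; rewrite -rcons_cons mem_rcons inE => /predU1P[->//|]; exact: a0.
  - rewrite rcons_path p0 /= l0.
    apply: le_lt_trans (euclid_dist_triangle _ _ x) _.
    by rewrite (euclid_distC x); move: jx kx => /=; lra.
  - by rewrite last_rcons.
have KD : K `&` D = K.
  apply: cK.
  - have K0 : K (g 0) by exists 0 => //=; rewrite in_itv /= lexx ler01.
    have [j aj j0] := KX _ K0.
    exists (g 0); split => //; exists j => //.
    exists j, [::]; split => //; last by exists (g 0).
    by move=> i; rewrite inE => /eqP ->.
  - by exists D.
  - exists (~` D'); first exact: open_closedC.
    apply/seteqP; split=> x [Kx].
      by move=> /DD'.
    move=> nD'x; split => //; have [j aj jx] := KX _ Kx.
    have [rj|nrj] := pselect (reach j); first by exists j.
    by exfalso; apply: nD'x; exists j.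
have : K (g 1) by exists 1 => //=; rewrite in_itv /= lexx ler01.
rewrite -KD => -[_ [j [j0 [s [a0 p0 A0 l0]]] jx]].
by exists j0, s; split => //; rewrite l0; exists (g 1).
Qed.

Lemma connected_inP A B : connected_in A B X <->
  exists j s, point_chain A B j s.
Proof.
split; first exact: connected_point_chain.
move=> [j [s /point_chain_joined[a [b [Aa Bb]]]]].
exact: joined_connected.
Qed.

End paths.

Section shell.
Context {R : realType} {d : nat}.
Implicit Types (A B X : set 'rV[R]_d).

(** A path from [connected_in] is continuous on [0, 1] only; passing to a chain of centres and back
    replaces it by one continuous on R. *)
Lemma connected_joined A B X : connected_in A B X ->
  exists a b, [/\ A a, B b & joined (covered X) a b].
Proof.
have XE : X = [set p | exists2 j, X j & p = idfun j].
  by apply/seteqP; split=> [p Xp|p [j Xj ->]//]; exists p.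
rewrite [X in connected_in _ _ X]XE => /connected_point_chain[j [s /point_chain_joined]].
by rewrite -XE.
Qed.

(** Either the path ends in the shell, or its norm takes the value [n%:R - M] on the way and the
    path is stopped there. *)
Lemma connected_box_shell (M : R) (n : nat) A B X : 0 < M -> 2 * M <= n%:R ->
  (forall a, A a -> `|a| <= n%:R - M) -> (forall b, B b -> n%:R - 2 * M < `|b|) ->
  connected_in A B X -> connected_in A (box_shell M n) X.
Proof.
move=> M0 Mn An Bn /connected_joined[a [b [Aa Bb [g [cg g0 g1 Ug]]]]].
have shellP x : n%:R - 2 * M < `|x| <= n%:R - M -> box_shell M n x.
  move=> /andP[x1 x2]; split; first by apply/boxP => //; lra.
  have r0 : 0 <= n%:R - 2 * M by lra.
  by move=> /(boxP _ r0); rewrite leNgt x1.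
have [bn|bn] := leP `|b| (n%:R - M).
  apply: joined_connected Aa (_ : box_shell M n b) _; last by exists g.
  by apply: shellP; rewrite bn Bn.
have cng : continuous (fun t => `|g t|).
  by move=> t; apply: (@continuous_comp _ _ _ g Num.norm); [exact: cg|exact: norm_continuous].
have := @IVT R (fun t => `|g t|) 0 1 (n%:R - M) ler01 (continuous_subspaceT cng).
rewrite g0 g1 ge_min (An _ Aa) /= le_max (ltW bn) orbT => /(_ isT)[t].
rewrite in_itv /= => t01 gt.
apply: (@joined_connected _ _ A (box_shell M n) X a (g t)) => //.
  by apply: shellP; rewrite gt lexx andbT; lra.
exists (fun s => g (t * s)); split.
- move=> s; apply: (@continuous_comp _ _ _ ( *%R t) g); last exact: cg.
  exact: mulrl_continuous.
- by rewrite mulr0.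
- by rewrite mulr1.
- by move=> s s01; apply: Ug; nra.
Qed.

End shell.

(** * Measurability of the connection events *)

Lemma measurable_preimageT {d1 d2 : measure_display} {T1 : measurableType d1}
    {T2 : measurableType d2} (f : T1 -> T2) (B : set T2) :
  measurable_fun setT f -> measurable B -> measurable (f @^-1` B).
Proof. by move=> mf mB; rewrite -[_ @^-1` _]setTI; exact: mf. Qed.

Lemma measurable_exists {dT : measure_display} {T : measurableType dT}
    {J : countType} (A : J -> set T) :
  (forall j, measurable (A j)) -> measurable [set t | exists j, A j t].
Proof.
move=> mA; have -> : [set t | exists j, A j t] = \bigcup_j A j.
  by apply/seteqP; split=> [t [j Aj]|t [j _ Aj]]; exists j.
by apply: countable_bigcupT_measurable => //; exact: countableP.
Qed.

Lemma measurable_forall {dT : measure_display} {T : measurableType dT}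
    {J : countType} (A : J -> set T) :
  (forall j, measurable (A j)) -> measurable [set t | forall j, A j t].
Proof.
move=> mA; have -> : [set t | forall j, A j t] = ~` [set t | exists j, (~` A j) t].
  apply/seteqP; split=> [t At [j]|t nA j]; first by apply; exact: At.
  by apply: contrapT => nAj; apply: nA; exists j.
by apply: measurableC; apply: measurable_exists => j; exact: measurableC.
Qed.

Lemma measurable_imply {dT : measure_display} {T : measurableType dT}
    (Q : Prop) (A : set T) : (Q -> measurable A) -> measurable [set t | Q -> A t].
Proof.
have [q|nq] := pselect Q => mA.
  have -> : [set t | Q -> A t] = A; last exact: mA.
  by apply/seteqP; split=> t //=; exact.
by have -> : [set t | Q -> A t] = setT by apply/seteqP; split=> t //= _ /nq.
Qed.

Section euclid_measurable.
Context {R : realType} {d : nat}.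

Lemma continuous_measurable_euclid (f : euclid R d -> euclid R d) :
  continuous (f : 'rV[R]_d -> 'rV[R]_d) -> measurable_fun setT f.
Proof.
move=> cf; apply: (@measurability _ _ (euclid R d) (euclid R d) setT f open) => //.
move=> _ [U oU <-]; rewrite setTI; apply: sub_sigma_algebra.
by move/continuousP : cf; apply.
Qed.

Lemma measurable_coord_euclid (i : 'I_d) :
  measurable_fun setT (fun p : euclid R d => (p : 'rV[R]_d) ord0 i).
Proof.
apply: (@measurability _ _ (euclid R d) R setT _ _ (RGenOInfty.measurableE R)).
move=> _ [_ [x ->] <-].
rewrite setTI; apply: sub_sigma_algebra.
have /continuousP := @coord_continuous R 1 d ord0 i; apply.
exact: rray_open.
Qed.

Lemma measurable_shift_euclid (v : 'rV[R]_d) :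
  measurable_fun setT ((fun p : 'rV[R]_d => p + v) : euclid R d -> euclid R d).
Proof.
have cv : continuous (fun p : 'rV[R]_d => p + v).
  by move=> p; apply: continuousD; [|exact: cst_continuous].
exact: (continuous_measurable_euclid cv).
Qed.

Lemma measurable_cube (M : R) (N : nat) : measurable (cube M N : set (euclid R d)).
Proof.
apply: measurable_forall => i.
rewrite [X in measurable X](_ : _ =
  (fun p : euclid R d => (p : 'rV[R]_d) ord0 i) @^-1` `[0, M * mesh N]).
  exact: measurable_preimageT (measurable_coord_euclid i) _.
by apply/seteqP; split=> p; rewrite /= in_itv.
Qed.

Lemma measurable_euclid_dist {dT : measure_display} {T : measurableType dT}
    (f g : T -> euclid R d) : measurable_fun setT f -> measurable_fun setT g ->
  measurable_fun setT (fun t => euclid_dist (f t) (g t)).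
Proof.
move=> mf mg; have ms : measurable_fun setT (@Num.sqrt R).
  by apply: continuous_measurable_fun; exact: sqrt_continuous.
suff mfg : measurable_fun setT (fun t => \sum_(i < d)
    ((f t : 'rV[R]_d) ord0 i - (g t : 'rV[R]_d) ord0 i) ^+ 2).
  exact: measurableT_comp ms mfg.
apply: measurable_sum => i; apply: measurable_funX; apply: measurable_funB.
  exact: measurableT_comp (measurable_coord_euclid i) mf.
exact: measurableT_comp (measurable_coord_euclid i) mg.
Qed.

Lemma measurable_near_set (A : set 'rV[R]_d) :
  measurable (near_set A : set (euclid R d)).
Proof.
apply: sub_sigma_algebra.
have -> : near_set A = \bigcup_(a in A) [set x | euclid_dist a x < 1 / 2].
  apply/seteqP; split=> [x [a Aa ax]|x [a Aa /= ax]].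
    by exists a => //=; rewrite euclid_distC.
  by exists a => //; rewrite euclid_distC.
by apply: bigcup_open => a _; exact: open_euclid_ball.
Qed.

Lemma measurable_connected_in {dT : measure_display} {T : measurableType dT}
    {J : countType} (pt : J -> T -> euclid R d) (act : J -> set T)
    (A B : set 'rV[R]_d) :
  (forall j, measurable_fun setT (pt j)) -> (forall j, measurable (act j)) ->
  measurable [set t | connected_in A B
    [set p | exists2 j, act j t & p = pt j t]].
Proof.
move=> mpt mact.
have -> : [set t | connected_in A B [set p | exists2 j, act j t & p = pt j t]] =
  [set t | exists js : J * seq J,
    point_chain (pt ^~ t) (act ^~ t) A B js.1 js.2].
  apply/seteqP; split=> t /=; rewrite connected_inP.
    by move=> [j [s js]]; exists (j, s).
  by move=> [[j s] js]; exists j, s.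
apply: measurable_exists => -[j s] /=.
rewrite [X in measurable X](_ : _ =
  [set t | forall i, i \in j :: s -> act i t] `&`
  [set t | path (fun i k => euclid_dist (pt i t) (pt k t) < 1) j s] `&`
  (pt j @^-1` near_set A) `&` (pt (last j s) @^-1` near_set B)); last first.
  by apply/seteqP; split=> t => [[]|[[[]]]]//.
apply: measurableI; last exact: measurable_preimageT (measurable_near_set B).
apply: measurableI; last exact: measurable_preimageT (measurable_near_set A).
apply: measurableI.
  apply: (measurable_forall (A := fun i => [set t | i \in j :: s -> act i t])).
  by move=> i; apply: measurable_imply => _; exact: mact.
elim: s j => [|k s IH] j /=.
  by rewrite [X in measurable X](_ : _ = setT)//; apply/seteqP; split.
rewrite [X in measurable X](_ : _ =
  [set t | euclid_dist (pt j t) (pt k t) < 1] `&`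
  [set t | path (fun i k => euclid_dist (pt i t) (pt k t) < 1) k s]); last first.
  by apply/seteqP; split=> t /= => [/andP[]|[-> ->]].
apply: measurableI => //.
have /(_ measurableT [set true] Logic.I) :=
  measurable_fun_ltr (measurable_euclid_dist (mpt j) (mpt k)) (measurable_cst (1 : R)).
by rewrite setTI.
Qed.

End euclid_measurable.

(** * Measurability of the quantile transform and of the Cox points *)

Section quantile.
Context {R : realType}.
Variable F : R -> R.
Hypotheses (F_nd : {homo F : s t / s <= t}) (F1 : F 1 = 1).

Lemma quantile_has_inf (v : R) : v <= 1 -> has_inf [set t | 0 <= t /\ v <= F t].
Proof.
by move=> v1; split; [exists 1; rewrite /= F1|exists 0 => t []].
Qed.

Lemma quantile_bounds (v : R) : v <= 1 -> 0 <= quantile F v <= 1.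
Proof.
move=> v1; have [ne lb] := quantile_has_inf v1; apply/andP; split.
  by apply: lb_le_inf => // t [].
by apply: ge_inf => //=; rewrite F1.
Qed.

(** As [F] is nondecreasing, a strict bound on the infimum is witnessed by a rational level; with
    [v] and [F] random, this becomes a countable union of events. *)
Lemma quantile_lt (v t : R) : v <= 1 ->
  quantile F v < t <->
  exists q : rat, 0 <= (ratr q : R) < t /\ v <= F (ratr q).
Proof.
move=> v1; have [ne lb] := quantile_has_inf v1; split.
  move=> /(inf_lt ne)[s [s0 vs] st].
  have [q] := rat_in_itvoo st; rewrite in_itv /= => /andP[sq qt].
  exists q; rewrite (le_trans s0 (ltW sq)) qt; split => //.
  by apply: le_trans vs _; apply: F_nd; exact: ltW.
move=> [q [/andP[q0 qt] vq]]; apply: le_lt_trans qt.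
exact: ge_inf.
Qed.

End quantile.

Section cox_measurability.
Context {R : realType} {d : nat} {M : R} {N : nat}.
Context {dS : measure_display} {S : measurableType dS}.
Variable E : @environment R d M N dS S.
Variables (Gamma : euclid R d -> R) (Gamma_inv : R -> euclid R d).
Hypothesis hGamma : bimeasurable_bijection (cube M N : set (euclid R d))
  (`[0, 1] : set R) Gamma Gamma_inv.
Context {dW : measure_display} {W : measurableType dW}.
Variable Y : Zlat d -> W -> S.
Hypothesis mY : forall z, measurable_fun setT (Y z).
Variable v : Zlat d -> nat -> W -> R * R.
Hypotheses (mv : forall k i, measurable_fun setT (v k i))
  (v_strip : forall k i w, strip (v k i w)).

Lemma measurable_config_of : measurable_fun setT (config_of Y).
Proof. by apply: measurable_to_config => z; exact: mY. Qed.

Lemma measurable_env_U k : measurable_fun setT (fun w => env_U E k (config_of Y w)).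
Proof. exact: measurableT_comp (env_U_measurable E k) measurable_config_of. Qed.

(** [Gamma] is controlled on the cube only, hence the intersection with the cell. *)
Definition cdf_set (k : Zlat d) (t : R) : set (euclid R d) :=
  cell M N k `&` [set p | Gamma ((p : 'rV[R]_d) - M *: site N k) <= t].

Lemma measurable_cdf_set k t : measurable (cdf_set k t).
Proof.
have mD := bb_fun_measurable hGamma (measurable_cube M N)
  (measurable_itv `]-oo, t]).
have := measurable_preimageT (measurable_shift_euclid (- (M *: site N k))) mD.
congr measurable; apply/seteqP; split=> p [pc pt]; split => //.
Qed.

Lemma cell_cdfE k y t : cell_cdf E Gamma k y t = fine (env_Q E k y (cdf_set k t)).
Proof. by []. Qed.

Lemma cdf_set1 k : cdf_set k 1 = cell M N k.
Proof.
apply/seteqP; split=> [p []//|p cp]; split => //=.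
by have := bb_fun hGamma cp; rewrite /= in_itv /= => /andP[].
Qed.

Lemma measurable_cell_cdf k t :
  measurable_fun setT (fun w => cell_cdf E Gamma k (config_of Y w) t).
Proof.
have mQ := measurable_kernel (env_Q E k) (cdf_set k t) (measurable_cdf_set k t).
have mQY := measurableT_comp mQ measurable_config_of.
exact: measurableT_comp (fine_measurable measurableT) mQY.
Qed.

Lemma cell_cdf_nd k y : {homo cell_cdf E Gamma k y : s t / s <= t}.
Proof.
have finQ s : env_Q E k y (cdf_set k s) \is a fin_num.
  rewrite ge0_fin_numE ?measure_ge0//; apply: (@le_lt_trans _ _ 1%E).
    rewrite -(env_Q_cell E k y) -cdf_set1; apply: le_measure; rewrite ?inE.
    - exact: measurable_cdf_set.
    - exact: measurable_cdf_set.
    - by rewrite cdf_set1 => p [].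
  exact: ltry.
move=> s t st; rewrite !cell_cdfE; apply: (fine_le (finQ s) (finQ t)).
apply: le_measure; rewrite ?inE; [exact: measurable_cdf_set..|].
by move=> p [cp /= ps]; split => //=; exact: le_trans st.
Qed.

Lemma cell_cdf1 k y : cell_cdf E Gamma k y 1 = 1.
Proof.
by rewrite cell_cdfE cdf_set1 env_Q_cell. Qed.

Let F w k := cell_cdf E Gamma k (config_of Y w).
Let fst_v01 k i w : 0 <= (v k i w).1 <= 1.
Proof. by have [] := v_strip k i w; rewrite /= in_itv. Qed.

Lemma measurable_quantile k i :
  measurable_fun setT (fun w => quantile (cell_cdf E Gamma k (config_of Y w)) (v k i w).1).
Proof.
have mv1 : measurable_fun setT (fun w => (v k i w).1).
  exact: measurableT_comp (mv k i).
apply: (measurability _ (RGenInftyO.measurableE R)) => _ [_ [t ->] <-].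
rewrite setTI.
rewrite [X in measurable X](_ : _ = [set w | exists q : rat,
  ([set w | 0 <= (ratr q : R) < t] `&`
   [set w | (v k i w).1 <= F w k (ratr q)]) w]); last first.
  have v1 w : (v k i w).1 <= 1 by have /andP[] := fst_v01 k i w.
  apply/seteqP; split=> w /=; rewrite in_itv /=.
    by move=> /(quantile_lt (cell_cdf_nd k _) (cell_cdf1 k _) _ (v1 w)).
  by move=> /(quantile_lt (cell_cdf_nd k _) (cell_cdf1 k _) _ (v1 w)).
apply: measurable_exists => q; apply: measurableI.
  have [h|h] := boolP (0 <= (ratr q : R) < t).
    by rewrite [X in measurable X](_ : _ = setT)//; apply/seteqP; split.
  by rewrite [X in measurable X](_ : _ = set0)//; apply/seteqP; split.
have /(_ measurableT [set true] Logic.I) :=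
  measurable_fun_ler mv1 (measurable_cell_cdf k (ratr q)).
by rewrite setTI.
Qed.

Definition cox_point (k : Zlat d) (i : nat) (w : W) : euclid R d :=
  M *: site N k + (Gamma_inv
    (quantile (cell_cdf E Gamma k (config_of Y w)) (v k i w).1) : 'rV[R]_d).

Lemma cox_point_cell k i w : cell M N k (cox_point k i w).
Proof.
rewrite /cell /cox_point /= addrC addKr.
apply: (bb_inv_fun hGamma); rewrite /= in_itv /=.
apply: quantile_bounds; [exact: cell_cdf1|].
by have /andP[] := fst_v01 k i w.
Qed.

Lemma measurable_cox_point k i : measurable_fun setT (cox_point k i).
Proof.
have mg : measurable_fun setT (fun w => Gamma_inv
    (quantile (cell_cdf E Gamma k (config_of Y w)) (v k i w).1)).
  apply: (measurable_comp (measurable_itv `[0, 1]) _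
    (bb_inv_measurable hGamma) (measurable_quantile k i)).
  move=> _ [w _ <-]; rewrite /= in_itv /=.
  apply: quantile_bounds; [exact: cell_cdf1|].
  by have /andP[] := fst_v01 k i w.
have := measurableT_comp (measurable_shift_euclid (M *: site N k)) mg.
by apply: eq_measurable_fun => w _; rewrite /cox_point /= addrC.
Qed.

Definition cox_active (k : Zlat d) (i : nat) : set W :=
  [set w | (v k i w).2 <= env_U E k (config_of Y w)].

Lemma measurable_cox_active k i : measurable (cox_active k i).
Proof.
have mv2 : measurable_fun setT (fun w => (v k i w).2).
  exact: measurableT_comp (mv k i).
have /(_ measurableT [set true] Logic.I) :=
  measurable_fun_ler mv2 (measurable_env_U k).
by rewrite setTI.
Qed.

Lemma cox_pointsE w :
  cox_points E Gamma Gamma_inv (config_of Y w) (fun k i => v k i w) =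
  [set p | exists2 j : Zlat d * nat, cox_active j.1 j.2 w & p = cox_point j.1 j.2 w].
Proof.
apply/seteqP; split=> [p [k [i [a ->]]]|p [[k i] a ->]]; first by exists (k, i).
by exists k, i.
Qed.

Lemma measurable_cox_connected (A B : set 'rV[R]_d) :
  measurable [set w | connected_in A B
    (cox_points E Gamma Gamma_inv (config_of Y w) (fun k i => v k i w))].
Proof.
have := measurable_connected_in (J := (Zlat d * nat)%type)
  (pt := fun j => cox_point j.1 j.2) (act := fun j => cox_active j.1 j.2) A B
  (fun j => measurable_cox_point j.1 j.2) (fun j => measurable_cox_active j.1 j.2).
by congr measurable; apply/seteqP; split=> w; rewrite /= cox_pointsE.
Qed.

End cox_measurability.

(** * Counting open walks *)

Section walks.
Context {d : nat}.
Implicit Types (k u v : Zlat d) (L m r : nat) (s : seq (Zlat d)).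

Lemma linf_dist_le u v L :
  (linf_dist u v <= L)%N <-> forall i, (`|u ord0 i - v ord0 i| <= L)%N.
Proof.
split=> [/bigmax_leqP h i|h]; first exact: h.
by apply/bigmax_leqP => i _.
Qed.

Lemma linf_dist_triangle u v k :
  (linf_dist u v <= linf_dist u k + linf_dist k v)%N.
Proof.
apply/linf_dist_le => i.
have /linf_dist_le/(_ i) := leqnn (linf_dist u k).
have /linf_dist_le/(_ i) := leqnn (linf_dist k v).
lia.
Qed.

Definition box_seq L : seq (Zlat d) :=
  [seq \row_i ((f i : nat)%:Z - L%:Z) | f : {ffun 'I_d -> 'I_(2 * L).+1}].

Lemma mem_box_seq L v : (forall i, (`|v ord0 i| <= L)%N) -> v \in box_seq L.
Proof.
move=> vL; apply/mapP.
exists [ffun i => inord (absz (v ord0 i + L%:Z))]; first by rewrite mem_enum.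
apply/rowP => i; rewrite mxE ffunE inordK; have := vL i; last by lia.
by have -> : v 0 i = v ord0 i by []; lia.
Qed.

Definition ball_seq L k : seq (Zlat d) := [seq k + v | v <- box_seq L].

Lemma mem_ball_seq L k u : (linf_dist k u <= L)%N -> u \in ball_seq L k.
Proof.
move=> /linf_dist_le ku; apply/mapP; exists (u - k).
  by apply: mem_box_seq => i; rewrite !mxE distnC; exact: ku.
by rewrite addrC subrK.
Qed.

Fixpoint walks L m k : seq (seq (Zlat d)) :=
  if m is m'.+1 then
    flatten [seq [seq u :: s | s <- walks L m' u] | u <- ball_seq L k]
  else [:: [::]].

Lemma size_walks L m k : size (walks L m k) = (size (box_seq L) ^ m)%N.
Proof.
elim: m k => //= m IH k; rewrite size_flatten /shape -map_comp.
rewrite (eq_map (g := fun=> size (box_seq L) ^ m)%N); last first.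
  by move=> u /=; rewrite size_map IH.
rewrite sumnE big_map big_const_seq count_predT iter_addn_0 [size (ball_seq L k)]size_map.
by rewrite expnS mulnC.
Qed.

Lemma size_in_walks L m k s : s \in walks L m k -> size s = m.
Proof.
elim: m k s => [|m IH] k s /=; first by rewrite inE => /eqP ->.
by move=> /flattenP[_ /mapP[u _ ->] /mapP[s' /IH <- ->]].
Qed.

Definition lnear L u v : bool := (linf_dist u v <= L)%N.

Lemma mem_walks L m k s : path (lnear L) k s -> size s = m -> s \in walks L m k.
Proof.
elim: m k s => [|m IH] k [|u s] //= /andP[ku us] [sm].
apply/flattenP; exists [seq u :: s | s <- walks L m u]; last first.
  by apply: map_f; exact: IH.
by apply/mapP; exists u => //; exact: mem_ball_seq.
Qed.

Lemma path_linf_dist L k s : path (lnear L) k s ->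
  (linf_dist (last k s) 0 <= linf_dist k 0 + L * size s)%N.
Proof.
elim: s k => [|u s IH] k /=; first by rewrite muln0 addn0.
move=> /andP[ku /IH us]; apply: leq_trans us _.
have := linf_dist_triangle u 0 k.
have -> : linf_dist u k = linf_dist k u.
  by apply: eq_bigr => i _; rewrite distnC.
by rewrite /lnear in ku; rewrite mulnS; lia.
Qed.

(** Removing loops keeps the endpoint, so the simple path still has at least [m] steps and can be
    cut after [m] of them. Distinct sites are what makes the bits along it independent. *)
Lemma path_to_walk L m k s (o : pred (Zlat d)) : path (lnear L) k s ->
  all o (k :: s) -> (linf_dist k 0 + L * m < linf_dist (last k s) 0)%N ->
  exists2 s', s' \in walks L m k & uniq (k :: s') && all o (k :: s').
Proof.
move=> ks aks; case: (shortenP ks) => s' ks' us' ss' far.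
have sz : (m <= size s')%N.
  rewrite leqNgt; apply/negP => sm.
  have := path_linf_dist ks'; rewrite leqNgt => /negP; apply.
  by apply: leq_ltn_trans far; rewrite leq_add2l leq_mul2l (ltnW sm) orbT.
exists (take m s').
  by apply: mem_walks; [exact: take_path|rewrite size_takel].
apply/andP; split; first by rewrite -[_ :: _]/(take m.+1 (k :: s')) take_uniq.
move: aks => /= /andP[-> aks] /=; apply/allP => u /mem_take us.
by move/allP : aks; apply; exact: ss'.
Qed.

End walks.

Section walk_probability.
Context {R : realType} {dW : measure_display} {W : measurableType dW}.
Variable P : probability W R.

Lemma probability_union_bound (T : choiceType) (l : seq T) (A : T -> set W) (c : R) :
  (forall i, i \in l -> measurable (A i)) -> (forall i, i \in l -> (P (A i) <= c%:E)%E) ->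
  (P [set w | exists2 i, i \in l & A i w] <= ((size l)%:R * c)%:E)%E.
Proof.
elim: l => [|i l IH] mA Ac.
  rewrite [X in P X](_ : _ = set0) ?measure0 ?mul0r//.
  by apply/seteqP; split=> w // [].
have mU : measurable [set w | exists2 i, i \in l & A i w].
  rewrite [X in measurable X](_ : _ = \big[setU/set0]_(i <- l) A i).
    rewrite big_seq; apply: bigsetU_measurable => j jl; apply: mA.
    by rewrite inE jl orbT.
  by rewrite -bigcup_seq; apply/seteqP; split=> w [j jl Aj]; exists j.
rewrite [X in P X](_ : _ = A i `|` [set w | exists2 i, i \in l & A i w]); last first.
  apply/seteqP; split=> w.
    move=> [j]; rewrite inE => /predU1P[->|jl] Aj; first by left.
    by right; exists j.
  by move=> [Ai|[j jl Aj]]; [exists i|exists j] => //; rewrite inE ?eqxx ?jl ?orbT.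
apply: le_trans (measureU2 P _ _) _ => //; first by apply: mA; exact: mem_head.
rewrite /= -natr1 mulrDl mul1r EFinD addeC; apply: leeD.
  by apply: Ac; exact: mem_head.
by apply: IH => j jl; [apply: mA|apply: Ac]; rewrite inE jl orbT.
Qed.

Context {d : nat}.
Variables (bit : Zlat d -> W -> bool) (p : R).
Hypotheses (bit_iid : iid P bit) (bit_p : forall k, P [set w | bit k w] = p%:E).

Lemma probability_all_bits (s : seq (Zlat d)) : uniq s ->
  P [set w | all (bit ^~ w) s] = (p ^+ size s)%:E.
Proof.
move=> us; have [mb ib _] := bit_iid.
rewrite [X in P X](_ : _ = \big[setI/setT]_(k <- s) [set w | bit k w]); last first.
  elim: {us} s => [|k s IH]; first by rewrite big_nil; apply/seteqP; split.
  rewrite big_cons -IH; apply/seteqP; split=> w /=; first by move=> /andP[].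
  by move=> [-> ->].
rewrite ib//; last by move=> k _; exists [set true] => //; rewrite setTI.
elim: s {us} => [|k s IH]; first by rewrite big_nil.
by rewrite big_cons IH bit_p exprS EFinM.
Qed.

Definition long_walk (L m : nat) (l : seq (Zlat d)) : set W :=
  [set w | exists2 k, k \in l & exists2 s, s \in walks L m k &
     uniq (k :: s) && all (bit ^~ w) (k :: s)].

Lemma measurable_all_bits (s : seq (Zlat d)) : measurable [set w | all (bit ^~ w) s].
Proof.
have [mb _ _] := bit_iid; elim: s => [|k s IH].
  by rewrite [X in measurable X](_ : _ = setT)//; apply/seteqP; split.
rewrite [X in measurable X](_ : _ = [set w | bit k w] `&` [set w | all (bit ^~ w) s]).
  by apply: measurableI => //; have := mb k measurableT [set true] Logic.I; rewrite setTI.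
by apply/seteqP; split=> w /=; [move=> /andP[]|move=> [-> ->]].
Qed.

Lemma measurable_open_walk k s :
  measurable [set w | uniq (k :: s) && all (bit ^~ w) (k :: s)].
Proof.
have [us|nus] := boolP (uniq (k :: s)); first exact: measurable_all_bits.
by rewrite [X in measurable X](_ : _ = set0)//; apply/seteqP; split.
Qed.

Lemma measurable_in_seq (T : choiceType) (l : seq T) (A : T -> set W) :
  (forall i, measurable (A i)) -> measurable [set w | exists2 i, i \in l & A i w].
Proof.
move=> mA; rewrite [X in measurable X](_ : _ = \big[setU/set0]_(i <- l) A i).
  by apply: bigsetU_measurable.
by rewrite -bigcup_seq; apply/seteqP; split=> w [i il Ai]; exists i.
Qed.

Lemma measurable_walk_from L m k : measurable [set w | exists2 s, s \in walks L m k &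
  uniq (k :: s) && all (bit ^~ w) (k :: s)].
Proof. by apply: measurable_in_seq => s; exact: measurable_open_walk. Qed.

Lemma measurable_long_walk L m l : measurable (long_walk L m l).
Proof. by apply: measurable_in_seq => k; exact: measurable_walk_from. Qed.

Lemma probability_long_walk (L m : nat) (l : seq (Zlat d)) :
  (P (long_walk L m l)
   <= ((size l)%:R * ((size (@box_seq d L))%:R ^+ m * p ^+ m.+1))%:E)%E.
Proof.
have p0 : 0 <= p by rewrite -lee_fin -(bit_p 0); exact: measure_ge0.
apply: probability_union_bound => k _; first exact: measurable_walk_from.
rewrite -natrX -(size_walks L m k).
apply: probability_union_bound => s sw; first exact: measurable_open_walk.
(* [m] steps visit [m.+1] distinct sites; a sequence with a repetition contributes the empty
   event. *)
have [us|nus] := boolP (uniq (k :: s)).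
  by rewrite [leLHS](probability_all_bits us) /= (size_in_walks sw).
rewrite [X in P X](_ : _ = set0); last by apply/seteqP; split.
by rewrite measure0 lee_fin exprn_ge0.
Qed.

End walk_probability.

Section point_bits.
Context {R : realType} {dW : measure_display} {W : measurableType dW}.
Context {d : nat}.
Variables (V : Zlat d -> nat -> W -> R * R).

Lemma point_bitP (D : set (R * R)) k w :
  point_bit V D k w <-> exists i, D (V k i w).
Proof.
rewrite /point_bit /point_count; split=> [|[i Di]].
  apply: contraPP => /forallNP nD; rewrite eseries0 ?ltxx// => i _ _.
  by rewrite diracE memNset.
rewrite (nneseries_split 0 i.+1)//.
rewrite add0n big_nat_recr//= diracE mem_set// -addeA addeCA.
apply: (@lt_le_trans _ _ 1%E); first exact: lte01.
rewrite leeDl//; apply: adde_ge0; first exact: sume_ge0.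
exact: nneseries_ge0.
Qed.

Definition slab (rho : R) : set (R * R) := `[0, 1] `*` `[0, rho].

Lemma measurable_slab rho : measurable (slab rho).
Proof. by apply: measurableX; exact: measurable_itv. Qed.

Lemma slab_strip rho : slab rho `<=` strip.
Proof.
move=> x [x1 x2]; split => //.
by move: x2; rewrite /= !in_itv /= andbT => /andP[].
Qed.

Lemma slab_volume rho : 0 <= rho ->
  ((lebesgue_measure \x lebesgue_measure) (slab rho) = rho%:E)%E.
Proof.
move=> rho0; rewrite product_measure1E; [|exact: measurable_itv..].
rewrite /= !lebesgue_measure_itv /= !lte_fin ltr01 !sube0 mul1e.
by case: ltP => // rho0'; congr EFin; apply/le_anti; rewrite rho0 rho0'.
Qed.

End point_bits.

(** * Geometry of the cells, of side M / N *)

Section cells.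
Context {R : realType} {d : nat}.
Variables (M : R) (N : nat).
Hypotheses (hM : 1 <= M) (hN : (0 < N)%N).
Implicit Types (k u : Zlat d) (p : 'rV[R]_d).

Let a : R := M * mesh N.

Lemma mesh_gt0 : 0 < mesh N :> R.
Proof. by rewrite invr_gt0 ltr0n. Qed.

Let a_gt0 : 0 < a.
Proof. by apply: mulr_gt0; [apply: lt_le_trans hM|exact: mesh_gt0]. Qed.

Let aN : a * N%:R = M.
Proof. by rewrite -mulrA mulVf ?mulr1// pnatr_eq0 -lt0n. Qed.

Lemma cellP k p : cell M N k p ->
  forall i, 0 <= p ord0 i - M * mesh N * (k ord0 i)%:~R <= M * mesh N.
Proof. by move=> cp i; have := cp i; rewrite !mxE mulrA. Qed.

Lemma absz_leP (x : int) (L : nat) : (`|x| <= L)%N = (`|x%:~R : R| <= L%:R).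
Proof. by rewrite -intr_norm -natr_absz ler_nat. Qed.

(** With [a] the side of a cell, the corners differ in each coordinate by at most 1 + a, and 1 <= M
    = N a. *)
Lemma cells_near k u p q : cell M N k p -> cell M N u q ->
  euclid_dist p q < 1 -> lnear N.+1 k u.
Proof.
move=> /cellP kp /cellP uq pq; apply/linf_dist_le => i.
rewrite absz_leP rmorphB /= -(ler_pM2l a_gt0).
rewrite -{1}(gtr0_norm a_gt0) -normrM mulrBr ler_norml -natr1 mulrDr aN.
have := euclid_dist_coord p q i; rewrite ler_norml.
have key (m c x y r s e : R) : 1 <= m -> 0 <= r - x <= c -> 0 <= s - y <= c ->
    e < 1 -> - e <= r - s <= e -> - (m + c * 1) <= x - y <= m + c * 1.
  by lra.
exact: (key _ _ _ _ _ _ _ hM (kp i) (uq i) pq).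
Qed.

(** A coordinate of [p] is at most 3M + 1/2 <= 4M = 4N a in absolute value, and the corner lies
    within one more side. *)
Lemma cell_near_start k p : cell M N k p -> near_set (box (3 * M)) p ->
  (linf_dist k 0 <= (4 * N).+1)%N.
Proof.
move=> /cellP kp [b bM pb]; apply/linf_dist_le => i.
rewrite mxE subr0 absz_leP -(ler_pM2l a_gt0).
rewrite -{1}(gtr0_norm a_gt0) -normrM ler_norml -natr1 natrM mulrDr mulrCA aN.
have := euclid_dist_coord p b i; rewrite ler_norml.
have key (m c x r s e : R) : 1 <= m -> 0 <= r - x <= c ->
    - (3 * m) <= s <= 3 * m -> e < 1 / 2 -> - e <= r - s <= e ->
    - (4%:R * m + c * 1) <= x <= 4%:R * m + c * 1.
  by lra.
exact: (key _ _ _ _ _ _ hM (kp i) (bM i) pb).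
Qed.

(** A corner within [r] sides of the origin would keep [p] within [a * r.+1], and the shell point of
    its ball within 1/2 more, hence inside the box removed from the shell. *)
Lemma cell_near_shell k p (n r : nat) : 2 * M + 1 + a * (r.+1)%:R <= n%:R ->
  cell M N k p -> near_set (box_shell M n) p -> (r < linf_dist k 0)%N.
Proof.
move=> nr /cellP kp [b [_ /existsNP[i nbi]] pb]; rewrite ltnNge; apply/negP.
move=> /linf_dist_le/(_ i); rewrite mxE subr0 absz_leP -(ler_pM2l a_gt0).
rewrite -{1}(gtr0_norm a_gt0) -normrM ler_norml => k12; apply: nbi.
have := euclid_dist_coord p b i; rewrite ler_norml.
move: nr; rewrite -[r.+1%:R]natr1 mulrDr.
have key (m c x q s e t l : R) : 0 <= q - x <= c -> - t <= x <= t ->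
    e < 1 / 2 -> 2 * m + 1 + (t + c * 1) <= l -> - e <= q - s <= e ->
    - (l - 2 * m) <= s <= l - 2 * m.
  by lra.
exact: (key _ _ _ _ _ _ _ _ (kp i) k12 pb).
Qed.

End cells.

Lemma eventually_nonincreasing_is_cvgn (R : realType) (u : nat -> \bar R) (n0 : nat) :
  (forall n, (n0 <= n)%N -> (u n.+1 <= u n)%E) -> cvgn u.
Proof.
move=> un; have /cvg_ex[l ul] : cvgn [sequence u (n + n0)%N]_n.
  apply: ereal_nonincreasing_is_cvgn; apply/nonincreasing_seqP => n.
  by rewrite /= addSn; apply: un; rewrite leq_addl.
by apply/cvg_ex; exists l; move: ul; rewrite cvg_shiftn.
Qed.

(** * The lower bound: crossings force long open walks *)

Section crossing.
Context {R : realType} {d : nat} {M : R} {N : nat}.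
Context {dS : measure_display} {S : measurableType dS}.
Variable E : @environment R d M N dS S.
Variables (Gamma : euclid R d -> R) (Gamma_inv : R -> euclid R d).
Hypothesis hGamma : bimeasurable_bijection (cube M N : set (euclid R d))
  (`[0, 1] : set R) Gamma Gamma_inv.
Context {dW : measure_display} {W : measurableType dW}.
Variables (P : probability W R) (Y : Zlat d -> W -> S).
Variables (lam : R) (V : R -> Zlat d -> nat -> W -> R * R).
Hypotheses (hM : 1 <= M) (hN : (0 < N)%N) (hY : iid P Y)
  (hV : poisson_family P Y lam (V lam)).

Let X w := cox_points E Gamma Gamma_inv (config_of Y w) (fun k i => V lam k i w).

Definition crossing (n : nat) : set W :=
  [set w | connected_in (box (3 * M)) (box_shell M n) (X w)].

Let mY z : measurable_fun setT (Y z). Proof. by case: hY. Qed.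
Let mV k i : measurable_fun setT (V lam k i).
Proof. exact: pp_measurable (pf_process hV k) i. Qed.
Let V_strip k i w : strip (V lam k i w).
Proof. exact: pp_strip (pf_process hV k) i w. Qed.

Lemma measurable_crossing n : measurable (crossing n).
Proof. exact: (measurable_cox_connected E hGamma mY mV V_strip). Qed.

Lemma crossing_cvg : cvgn (fun n => P (crossing n)).
Proof.
(* From [4 * M] on, the box of radius 3M lies within the outer radius n - M of the shell, as cutting
   a path at the shell requires. *)
have [n0 n0M] : exists n0 : nat, 4 * M <= n0%:R.
  by exists (Num.bound (4 * M)); apply/ltW/archi_boundP; have := hM; lra.
apply: (@eventually_nonincreasing_is_cvgn _ _ n0) => n n0n.
apply: le_measure; rewrite ?inE; [exact: measurable_crossing..|].
have nM : 4 * M <= n%:R by apply: le_trans n0M _; rewrite ler_nat.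
have hM1 := hM; move=> w; apply: connected_box_shell; [lra|lra| |].
- have M3 : 0 <= 3 * M by lra.
  by move=> a /(boxP _ M3); lra.
- move=> b [_ nb]; rewrite ltNge; apply/negP => bn; apply: nb.
  by apply/boxP; rewrite -natr1; lra.
Qed.

Lemma thetaE : theta E P Y Gamma Gamma_inv V lam = limn (fun n => P (crossing n)).
Proof. by []. Qed.

Variable rho : R.
Hypothesis hrho : forall k y, env_U E k y <= rho.

(** The bound on [n] puts the shell beyond [(4 * N).+1 + N.+1 * m] in site indices: the first cell
    is within [(4 * N).+1] of the origin, and each of [m] steps gains at most [N.+1]. *)
Lemma crossing_walk m n w :
  2 * M + 1 + M * mesh N * ((4 * N).+1 + N.+1 * m).+1%:R <= n%:R ->
  crossing n w -> exists2 k, k \in ball_seq (4 * N).+1 (0 : Zlat d) &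
    exists2 s, s \in walks N.+1 m k &
    uniq (k :: s) && all (point_bit (V lam) (slab rho) ^~ w) (k :: s).
Proof.
move=> nm; rewrite /crossing /= /X (cox_pointsE E Gamma Gamma_inv Y (V lam)).
move=> /connected_inP[[k i] [s [act near start stop]]].
have cellj (j : Zlat d * nat) : cell M N j.1 (cox_point E Gamma Gamma_inv Y (V lam) j.1 j.2 w).
  exact: cox_point_cell.
have near' : path (lnear N.+1) k (map fst s).
  rewrite -[k]/((k, i).1) path_map; apply: sub_path near => j j' jj'.
  exact: (cells_near hM hN (cellj j) (cellj j') jj').
have occ : all (point_bit (V lam) (slab rho) ^~ w) (k :: map fst s).
  rewrite -[k :: _]/(map fst ((k, i) :: s)); apply/allP => _ /mapP[j /act aj ->].
  apply/point_bitP; exists j.2; have [v1 v2] := V_strip j.1 j.2 w.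
  split => //; move: v2; rewrite /= !in_itv /= andbT => -> /=.
  exact: le_trans aj (hrho _ _).
have lt_last := cell_near_shell hM hN nm (cellj _) stop.
have le_first := cell_near_start hM hN (cellj _) start.
exists k.
  apply: mem_ball_seq; apply: leq_trans le_first.
  by apply: eq_leq; apply: eq_bigr => t _; rewrite distnC.
apply: (path_to_walk near' occ).
rewrite -[k in last k]/((k, i).1) last_map; apply: leq_ltn_trans lt_last.
by rewrite leq_add2r.
Qed.

Lemma theta_le0 : 0 < lam -> 0 < rho ->
  lam * rho * (size (@box_seq d N.+1)).+1%:R <= 1 / 2 ->
  (theta E P Y Gamma Gamma_inv V lam <= 0)%E.
Proof.
move=> lam0 rho0 small; rewrite thetaE.
set D := size _ in small.
pose p : R := 1 - expR (- (lam * rho)).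
have lr0 : 0 < lam * rho by rewrite mulr_gt0.
have p_le : p <= lam * rho.
  by have := expR_ge1Dx (- (lam * rho)); rewrite /p; lra.
have p_ge0 : 0 <= p.
  have := expR_gt0 (- (lam * rho)); rewrite /p subr_ge0 => _.
  by rewrite -expR0 ler_expR; lra.
have p_le1 : p <= 1 by have := expR_gt0 (- (lam * rho)); rewrite /p; lra.
have Dp : D%:R * p <= 1 / 2.
  apply: le_trans small; rewrite mulrC; apply: ler_pM => //.
  by rewrite ler_nat.
have Dp0 : 0 <= D%:R * p by rewrite mulr_ge0.
pose C := (size (ball_seq (4 * N).+1 (0 : Zlat d)))%:R : R.
have bit_p k : P [set w | point_bit (V lam) (slab rho) k w] = p%:E.
  have vol := slab_volume (ltW rho0).
  rewrite (probability_point_bit hV); [|exact: measurable_slab|exact: slab_strip|].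
    by rewrite vol.
  by rewrite vol ltry.
have bit_iid : iid P (point_bit (V lam) (slab rho)).
  apply: (iid_point_bit hY hV); [exact: measurable_slab|exact: slab_strip|].
  by rewrite (slab_volume (ltW rho0)) ltry.
have bound m : (limn (fun n => P (crossing n)) <= (C * (1 / 2) ^+ m)%:E)%E.
  apply: lime_le; first exact: crossing_cvg.
  pose K := 2 * M + 1 + M * mesh N * ((4 * N).+1 + N.+1 * m).+1%:R.
  exists (Num.bound K) => // n /= Kn.
  have nK : K <= n%:R.
    apply: le_trans (_ : (Num.bound K)%:R <= n%:R); last by rewrite ler_nat.
    apply/ltW/archi_boundP; rewrite /K; have hM1 := hM.
    have : 0 <= M * mesh N * ((4 * N).+1 + N.+1 * m).+1%:R.
      by rewrite !mulr_ge0 ?ler0n//; [lra|rewrite invr_ge0 ler0n].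
    by lra.
  have walk_p := probability_long_walk bit_iid bit_p N.+1 m (ball_seq (4 * N).+1 (0 : Zlat d)).
  apply: le_trans (le_trans _ walk_p) _.
    apply: le_measure; rewrite ?inE; first exact: measurable_crossing.
      exact: (measurable_long_walk bit_iid).
    by move=> w; exact: crossing_walk.
  (* The bound is rearranged to [p * (D * p) ^ m], with [p <= 1] and [D * p <= 1 / 2]. *)
  rewrite lee_fin ler_wpM2l ?ler0n// exprS mulrCA -exprMn.
  rewrite -[leRHS]mul1r; apply: ler_pM => //; first exact: exprn_ge0.
  by rewrite lerXn2r ?nnegrE//; lra.
rewrite leNgt; apply/negP => t0.
have : limn (fun n => P (crossing n)) \is a fin_num.
  rewrite ge0_fin_numE ?(ltW t0)//; apply: le_lt_trans (bound 0) _.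
  exact: ltry.
move=> /fineK tE; move: t0 bound; rewrite -tE; set t := fine _.
rewrite lte_fin => t0 bound.
(* A positive limit [t] is refuted by an [m] above [C / t], as [m < 2 ^ m]. *)
have := archi_boundP (divr_ge0 (ler0n _ _ : 0 <= C) (ltW t0)).
set m := Num.bound _ => Cm; have := bound m; rewrite lee_fin leNgt => /negP; apply.
rewrite div1r exprVn -ltr_pdivlMr ?invr_gt0 ?exprn_gt0// invrK.
rewrite -ltr_pdivrMl// mulrC; apply: lt_trans Cm _.
by rewrite -natrX ltr_nat ltn_expl.
Qed.

End crossing.

(** * The field of good cells *)

Section lattice_cells.
Context {R : realType} {d : nat} {N : nat}.
Hypothesis hN : (0 < N)%N.
Implicit Types (z k u v : Zlat d).

(** Multiplying by N turns the real inequalities on the point b k into integer ones on its index. *)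
Lemma sites_aroundP (a b : nat) z k :
  sites_around N (a%:R : R) b%:R z k <-> forall i,
    ((z ord0 i - a%:Z) * N%:Z <= k ord0 i) && (k ord0 i < (z ord0 i + b%:Z) * N%:Z).
Proof.
have N0 : 0 < (N%:R : R) by rewrite ltr0n.
have E i : ((z ord0 i)%:~R - (a%:R : R) <= (site N k : 'rV[R]_d) ord0 i < (z ord0 i)%:~R + b%:R) =
  ((z ord0 i - a%:Z) * N%:Z <= k ord0 i) && (k ord0 i < (z ord0 i + b%:Z) * N%:Z).
  have -> : (site N k : 'rV[R]_d) ord0 i = (k ord0 i)%:~R / N%:R by rewrite !mxE mulrC.
  congr (_ && _).
    by rewrite (ler_pdivlMr _ _ N0) -(ler_int R) rmorphM rmorphB.
  by rewrite (ltr_pdivrMr _ _ N0) -(ltr_int R) rmorphM rmorphD.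
by split=> h i; [rewrite -E; exact: h|rewrite E; exact: h].
Qed.

Lemma IbP z k : @Ib R d N z k <-> forall i,
  (z ord0 i * N%:Z <= k ord0 i) && (k ord0 i < (z ord0 i + 1) * N%:Z).
Proof.
have := sites_aroundP 0 1 z k; rewrite /Ib => ->.
by split=> h i; have := h i; rewrite subr0.
Qed.

Lemma Ib1P z k : @Ib1 R d N z k <-> forall i,
  ((z ord0 i - 1) * N%:Z <= k ord0 i) && (k ord0 i < (z ord0 i + 2) * N%:Z).
Proof. exact: sites_aroundP 1 2 z k. Qed.

Lemma Ib2P z k : @Ib2 R d N z k <-> forall i,
  ((z ord0 i - 2) * N%:Z <= k ord0 i) && (k ord0 i < (z ord0 i + 3) * N%:Z).
Proof. exact: sites_aroundP 2 3 z k. Qed.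

Lemma linf_distC u v : linf_dist u v = linf_dist v u.
Proof. by apply: eq_bigr => i _; rewrite distnC. Qed.

Lemma Ib_Ib2 z k : @Ib R d N z k -> @Ib2 R d N z k.
Proof.
by move=> /IbP h; apply/Ib2P => i; have := h i; move: (k ord0 i) (z ord0 i) => x y; nia.
Qed.

Lemma Ib_Ib1 z u k : (linf_dist z u <= 1)%N -> @Ib R d N u k -> @Ib1 R d N z k.
Proof.
move=> /linf_dist_le zu /IbP h; apply/Ib1P => i; have := h i; have := zu i.
move: (k ord0 i) (z ord0 i) (u ord0 i) => x y t; nia.
Qed.

(** The cell containing [k] is found by Euclidean division of its coordinates by [N]. *)
Lemma Ib2_Ib z k : @Ib2 R d N z k ->
  exists2 u, @Ib R d N u k & (linf_dist z u <= 2)%N.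
Proof.
move=> /Ib2P h; exists (\row_i (k ord0 i %/ N%:Z)%Z).
  apply/IbP => i; rewrite mxE.
  have := divz_eq (k ord0 i) N; have := modz_ge0 (k ord0 i) (_ : N%:Z != 0).
  have := ltz_pmod (k ord0 i) (_ : 0 < N%:Z).
  move: (k ord0 i) => x; move: (x %/ _)%Z (x %% _)%Z => q r h1 h2 h3.
  have {}h1 := h1 hN.
  have {}h2 : 0 <= r by apply: h2; lia.
  by apply/andP; split; nia.
apply/linf_dist_le => i; rewrite mxE.
have := divz_eq (k ord0 i) N; have := modz_ge0 (k ord0 i) (_ : N%:Z != 0).
have := ltz_pmod (k ord0 i) (_ : 0 < N%:Z); have := h i.
move: (k ord0 i) (z ord0 i) => x y; move: (x %/ _)%Z (x %% _)%Z => q r h0 h1 h2 h3.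
have {}h1 := h1 hN.
have {}h2 : 0 <= r by apply: h2; lia.
nia.
Qed.

Lemma Ib2_linf_dist u v k :
  @Ib2 R d N u k -> @Ib2 R d N v k -> (linf_dist u v <= 4)%N.
Proof.
move=> /Ib2P hu /Ib2P hv; apply/linf_dist_le => i; have := hu i; have := hv i.
move: (k ord0 i) (u ord0 i) (v ord0 i) => x y t; nia.
Qed.

Lemma Ib_shift z u k : @Ib R d N (z + u) (k + u *+ N) <-> @Ib R d N z k.
Proof.
rewrite !IbP; split=> h i; have := h i; rewrite !mxE mulmxnE ?mxE;
  move: (k ord0 i) (u ord0 i) (z ord0 i) => x y t; rewrite -mulr_natr natz; nia.
Qed.

Lemma Ib2_shift z u k : @Ib2 R d N (z + u) (k + u *+ N) <-> @Ib2 R d N z k.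
Proof.
rewrite !Ib2P; split=> h i; have := h i; rewrite !mxE mulmxnE ?mxE;
  move: (k ord0 i) (u ord0 i) (z ord0 i) => x y t; rewrite -mulr_natr natz; nia.
Qed.

Lemma Ib2_finite k : @Ib2 R d N 0 k -> k \in ball_seq (3 * N) (0 : Zlat d).
Proof.
move=> /Ib2P h; apply: mem_ball_seq; apply/linf_dist_le => i; have := h i.
rewrite !mxE; move: (k ord0 i) => x; nia.
Qed.

End lattice_cells.

Section good_cells.
Context {R : realType} {d : nat} {N : nat}.
Variable delta : R.

(* Asking for points below the fixed height [delta] rather than below [u k]
   separates the Poisson points from the environment. *)
Definition good (u : Zlat d -> R) (b : Zlat d -> bool) (z : Zlat d) : Prop :=
  (exists2 k, @Ib R d N z k & 0 < u k) /\
  (forall k, @Ib2 R d N z k -> 0 < u k -> delta <= u k /\ b k).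

(** Measurability is asked at the sites of [Ib2 z] only, so that the lemma also applies to the
    sigma-algebra generated by the noise near [z]. *)
Lemma measurable_good {dT : measure_display} {T : measurableType dT}
    (u : Zlat d -> T -> R) (b : Zlat d -> T -> bool) (z : Zlat d) : (0 < N)%N ->
  (forall k, @Ib2 R d N z k -> measurable_fun setT (u k)) ->
  (forall k, @Ib2 R d N z k -> measurable_fun setT (b k)) ->
  measurable [set t | good (u ^~ t) (b ^~ t) z].
Proof.
move=> hN mu mb.
have mpos k : @Ib2 R d N z k -> measurable [set t | 0 < u k t].
  move=> zk; have /(_ measurableT [set true] Logic.I) :=
    measurable_fun_ltr (measurable_cst (0 : R)) (mu k zk).
  by rewrite setTI.
have mge k : @Ib2 R d N z k -> measurable [set t | delta <= u k t].
  move=> zk; have /(_ measurableT [set true] Logic.I) :=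
    measurable_fun_ler (measurable_cst delta) (mu k zk).
  by rewrite setTI.
have mbk k : @Ib2 R d N z k -> measurable [set t | b k t].
  by move=> /mb /(_ measurableT [set true] Logic.I); rewrite setTI.
rewrite [X in measurable X](_ : _ =
  [set t | exists k, [set t | @Ib R d N z k /\ 0 < u k t] t] `&`
  [set t | forall k, [set t | @Ib2 R d N z k ->
     (~` [set t | 0 < u k t] `|` ([set t | delta <= u k t] `&` [set t | b k t])) t] t]).
- apply: measurableI.
    apply: measurable_exists => k; have [zk|nzk] := pselect (@Ib R d N z k).
      rewrite [X in measurable X](_ : _ = [set t | 0 < u k t]).
        by apply: mpos; exact: (Ib_Ib2 hN).
      by apply/seteqP; split=> t //= [].
    by rewrite [X in measurable X](_ : _ = set0)//; apply/seteqP; split=> t // [].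
  apply: measurable_forall => k; apply: measurable_imply => zk.
  apply: measurableU; first by apply: measurableC; exact: mpos.
  by apply: measurableI; [exact: mge|exact: mbk].
- apply/seteqP; split=> t.
    move=> [[k zk uk] h]; split; first by exists k.
    move=> k' zk' /=; have [uk'|] := pselect (0 < u k' t); last by left.
    by right; exact: h.
  move=> [[k [zk uk]] h]; split; first by exists k.
  by move=> k' zk' uk'; have [nuk'|] := h k' zk'.
Qed.

Lemma good_shift (u : Zlat d -> R) (b : Zlat d -> bool) (v z : Zlat d) :
  (0 < N)%N ->
  good (fun k => u (k + v *+ N)) (fun k => b (k + v *+ N)) z <-> good u b (z + v).
Proof.
move=> hN; split=> -[[k zk uk] h]; split.
- by exists (k + v *+ N) => //; apply/(Ib_shift hN).
- move=> k' zk'; have := h (k' - v *+ N); rewrite subrK; apply.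
  by apply/(Ib2_shift hN _ v); rewrite subrK.
- exists (k - v *+ N); last by rewrite subrK.
  by apply/(Ib_shift hN _ v); rewrite subrK.
- by move=> k' zk'; apply: h; apply/(Ib2_shift hN).
Qed.

End good_cells.

Section bernoulli_field.
Context {R : realType} {d : nat} {M : R} {N : nat}.
Context {dS : measure_display} {S : measurableType dS}.
Variable E : @environment R d M N dS S.
Context {dW : measure_display} {W : measurableType dW}.
Variables (P : probability W R) (Y : Zlat d -> W -> S).
Variables (lam : R) (V : Zlat d -> nat -> W -> R * R).
Hypotheses (hN : (0 < N)%N) (hY : iid P Y) (hV : poisson_family P Y lam V).
Hypothesis h1dep : one_dependent E.
Variable delta : R.
Hypothesis hdelta : 0 <= delta.

Definition bits (k : Zlat d) (w : W) : bool := point_bit V (slab delta) k w.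

(** A fixed map on pairs of configurations: invariance in law under shifts then applies to any
    measurable event of the field. *)
Definition good_pair (x : config d S * config d bool) (z : Zlat d) : bool :=
  `[< @good R d N delta (fun k => env_U E k x.1) x.2 z >].

Definition good_field (z : Zlat d) (w : W) : bool :=
  good_pair (config_of Y w, config_of bits w) z.

Lemma good_pair_shift x v z :
  good_pair (shift_config v x.1, shift_config (v *+ N) x.2) z = good_pair x (z + v).
Proof.
apply/asbool_equiv_eq; rewrite -good_shift//=.
have -> : (fun k => env_U E k (shift_config v x.1)) = (fun k => env_U E (k + v *+ N) x.1).
  by apply/funext => k; rewrite env_U_shift.
by [].
Qed.

Lemma measurable_good_pair z : measurable [set x | good_pair x z].
Proof.
rewrite [X in measurable X](_ : _ = [set x : config d S * config d bool |
  @good R d N delta (fun k => env_U E k x.1) (fun k => x.2 k) z]).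
  apply: (@measurable_good R d N delta _ (config d S * config d bool)%type
    (fun k x => env_U E k x.1) (fun k x => x.2 k)) => //.
    by move=> k _; exact: measurableT_comp (env_U_measurable E k) measurable_fst.
  by move=> k _; exact: measurableT_comp (measurable_coordinate k) measurable_snd.
by apply/seteqP; split=> x /asboolP.
Qed.

Lemma bits_iid : iid P bits.
Proof.
apply: (iid_point_bit hY hV); [exact: measurable_slab|exact: slab_strip|].
by rewrite slab_volume// ltry.
Qed.

Lemma measurable_field z : measurable_fun setT (good_field z).
Proof.
apply: (measurable_fun_bool true).
rewrite setTI [X in measurable X](_ : _ =
  (fun w => (config_of Y w, config_of bits w)) @^-1` [set x | good_pair x z]);
  last first.
  by apply/seteqP; split=> w.
apply: measurable_preimageT (measurable_good_pair z).
apply: measurable_fun_pair; apply: measurable_to_config => k.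
  by case: hY => + _ _; exact.
by case: bits_iid => + _ _; exact.
Qed.

End bernoulli_field.

Lemma sub_sigma_of_bool {dT : measure_display} {T : measurableType dT}
    (G : set (set T)) (f : T -> bool) :
  <<s G >> [set t | f t] -> sigma_of f `<=` <<s G >>.
Proof.
move=> sf _ [B _ <-].
have : measurable_fun setT (f : g_sigma_algebraType G -> bool).
  by apply: (measurable_fun_bool true); rewrite setTI.
by apply.
Qed.

(** * Finite dependence of the good field *)

Section field_dependence.
Context {R : realType} {d : nat} {M : R} {N : nat}.
Context {dS : measure_display} {S : measurableType dS}.
Variable E : @environment R d M N dS S.
Context {dW : measure_display} {W : measurableType dW}.
Variables (P : probability W R) (Y : Zlat d -> W -> S).
Variables (lam : R) (V : Zlat d -> nat -> W -> R * R).
Hypotheses (hN : (0 < N)%N) (hY : iid P Y) (hV : poisson_family P Y lam V).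
Hypothesis h1dep : one_dependent E.
Variable delta : R.

(** 1-dependence concerns the local measure; its total mass is U, since Q is a probability. *)
Lemma env_U_local (z k : Zlat d) (y y' : config d S) : @Ib R d N z k ->
  (forall z', (linf_dist z z' <= 1)%N -> y z' = y' z') -> env_U E k y = env_U E k y'.
Proof.
move=> zk yy'; have := h1dep zk yy' measurableT.
by rewrite /env_local !prob_kernel !mule1 => -[].
Qed.

(** The sites of I_b^{++}(z) lie in cells within distance 2 of [z], and 1-dependence looks one cell
    further. *)
Definition field_range (z : Zlat d) : set (Zlat d + Zlat d) :=
  [set i | match i with
           | inl u => (linf_dist z u <= 3)%N
           | inr k => @Ib2 R d N z k
           end].

Lemma field_local z : sigma_of (good_field E Y V delta z) `<=`
  <<s \bigcup_(i in field_range z) noise Y V i >>.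
Proof.
set G := \bigcup_(i in _) _; apply: sub_sigma_of_bool.
pose w0 : W := point; have sG i : field_range z i -> noise Y V i `<=` <<s G >>.
  by move=> zi A nA; apply: sub_sigma_algebra; exists i.
(* [T] is the sample space with only the noise in the range of [z]; measurability of the good event
   there is the claim. *)
pose T := g_sigma_algebraType G.
suff : measurable [set w : T | @good R d N delta
    (fun k => env_U E k (config_of Y w)) (bits V delta ^~ w) z].
  by congr (_ _); apply/seteqP; split=> w /asboolP.
apply: (@measurable_good R d N delta _ T (fun k w => env_U E k (config_of Y w))
  (bits V delta)) => //.
- move=> k /(Ib2_Ib hN)[u uk zu].
  (* Freezing the coordinates at distance more than 1 from [u] does not change
     [env_U E k], by 1-dependence. *)
  pose mask (w : T) : config d S :=
    fun z' => if (linf_dist u z' <= 1)%N then Y z' w else Y z' w0.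
  have -> : (fun w : T => env_U E k (config_of Y w)) = (fun w => env_U E k (mask w)).
    apply/funext => w; apply: (env_U_local uk) => z' uz'.
    by rewrite /mask uz'.
  suff mm : measurable_fun setT mask.
    exact: measurableT_comp (env_U_measurable E k) mm.
  apply: measurable_to_config => z'; rewrite /mask.
  have [uz'|uz'] := boolP (linf_dist u z' <= 1)%N; last exact: measurable_cst.
  move=> _ B mB; apply: (sG (inl z')); last by exists B.
  rewrite /field_range /=; apply: leq_trans (linf_dist_triangle z z' u) _.
  by rewrite (leq_add zu uz').
- move=> k zk _ B mB; apply: (sG (inr k) zk).
  by apply: sigma_process_point_bit; [exact: measurable_slab|exists B].
Qed.

(** The 6 is 3 + 3, from the coordinates of Y; for the Poisson processes, two windows sharing a site
    are at most 4 apart. *)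
Lemma field_range_disjoint (A B : set (Zlat d)) :
  (forall u v, A u -> B v -> (6 < linf_dist u v)%N) ->
  (\bigcup_(u in A) field_range u) `&` (\bigcup_(v in B) field_range v) = set0.
Proof.
move=> AB; apply/seteqP; split=> // -[t|k] [[u Au ut] [v Bv vt]];
  have := AB u v Au Bv; rewrite ltnNge => /negP; apply.
  apply: leq_trans (linf_dist_triangle u v t) _.
  by rewrite (linf_distC t v); move: ut vt; rewrite /field_range /=; lia.
by apply: leq_trans (Ib2_linf_dist hN ut vt) _.
Qed.

Lemma field_finitely_dependent : finitely_dependent P (good_field E Y V delta) 6.
Proof.
move=> A B AB.
have sub (C : set (Zlat d)) : <<s \bigcup_(u in C) sigma_of (good_field E Y V delta u) >> `<=`
    <<s \bigcup_(i in \bigcup_(u in C) field_range u) noise Y V i >>.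
  apply: smallest_sub; first exact: smallest_sigma_algebra.
  move=> D [u Cu uD]; have := field_local uD; apply: smallest_sub.
    exact: smallest_sigma_algebra.
  by move=> F [i ui iF]; apply: sub_gen_smallest; exists i => //; exists u.
move=> D D' /sub sD /sub sD'.
apply: independent_groups sD sD'.
- exact: noise_setI.
- exact: noise_setT.
- exact: noise_measurable hY hV.
- exact: noise_independent hY hV.
- exact: field_range_disjoint.
Qed.

End field_dependence.

(** * Infinite clusters as walks to every distance *)

Section far_clusters.
Context {d : nat}.
Implicit Types (o : Zlat d -> bool) (u v : Zlat d) (s : seq (Zlat d)).

Definition far_walk o u n s : bool :=
  [&& all o (u :: s), path nearest_neighbour u s & (n <= linf_dist u (last u s))%N].

(** Countable quantifiers over finite walks make this form measurable, and the walks are what yields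
    crossings. *)
Definition far_cluster o u : Prop := forall n, exists s, far_walk o u n s.

(** Balls of the lattice are finite, so a cluster is infinite exactly when it is unbounded. *)
Lemma infinite_clusterP o u : infinite_set (open_cluster o u) <-> far_cluster o u.
Proof.
split=> [inf n|far fin].
  apply: contrapT => /forallNP far; apply: inf.
  apply: (@sub_finite_set _ _ [set` ball_seq n u]); last exact: finite_seq.
  move=> v [s [os us <-]]; apply: mem_ball_seq; rewrite leqNgt; apply/negP => nv.
  by apply: (far s); rewrite /far_walk os us ltnW.
have /finite_seqP[t tE] := fin.
have [s /and3P[os us ns]] := far (\max_(v <- t) linf_dist u v).+1.
have : last u s \in t.
  by have : open_cluster o u (last u s); [exists s|rewrite tE].
move=> st; move: ns; rewrite ltnNge => /negP; apply.
by rewrite (big_rem _ st) /= leq_maxl.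
Qed.

Lemma nearest_neighbour_shift u v t :
  nearest_neighbour (u + t) (v + t) = nearest_neighbour u v.
Proof.
rewrite /nearest_neighbour; congr (_ == _); apply: eq_bigr => i _.
by rewrite !mxE opprD addrACA subrr addr0.
Qed.

Lemma linf_dist_shift u v t : linf_dist (u + t) (v + t) = linf_dist u v.
Proof. by apply: eq_bigr => i _; rewrite !mxE opprD addrACA subrr addr0. Qed.

Lemma far_walk_shift o u v n s :
  far_walk o (u + v) n [seq t + v | t <- s] = far_walk (fun z => o (z + v)) u n s.
Proof.
pose f t : Zlat d := t + v; rewrite -[u + v]/(f u) /far_walk.
rewrite -[f u :: _]/(map f (u :: s)) all_map path_map (@last_map _ _ f).
rewrite linf_dist_shift.
congr [&& _, _ & _]; apply: eq_path => t t'.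
exact: nearest_neighbour_shift.
Qed.

Lemma far_cluster_shift o v :
  far_cluster (fun z => o (z + v)) 0 <-> far_cluster o v.
Proof.
split=> far n; have [s us] := far n.
  by exists [seq t + v | t <- s]; rewrite -[v in far_walk _ v]add0r far_walk_shift.
exists [seq t - v | t <- s]; rewrite -far_walk_shift add0r -map_comp.
by rewrite (eq_map (g := id)) ?map_id// => t /=; rewrite subrK.
Qed.

Lemma measurable_far_cluster {dT : measure_display} {T : measurableType dT}
    (o : T -> Zlat d -> bool) (u : Zlat d) :
  (forall z, measurable [set t | o t z]) -> measurable [set t | far_cluster (o t) u].
Proof.
move=> mo; apply: measurable_forall => n; apply: measurable_exists => s.
have mall : measurable [set t | all (o t) (u :: s)].
  elim: (u :: s) => [|z s' IH].
    by rewrite [X in measurable X](_ : _ = setT)//; apply/seteqP; split.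
  rewrite [X in measurable X](_ : _ = [set t | o t z] `&` [set t | all (o t) s']).
    exact: measurableI.
  by apply/seteqP; split=> t /=; [move=> /andP[]|move=> [-> ->]].
rewrite /far_walk; case: (path _ _ _); last first.
  by rewrite [X in measurable X](_ : _ = set0)//; apply/seteqP; split=> t //=; rewrite andbF.
case: (n <= _)%N; last first.
  by rewrite [X in measurable X](_ : _ = set0)//; apply/seteqP; split=> t //=; rewrite andbF.
rewrite [X in measurable X](_ : _ = [set t | all (o t) (u :: s)])//.
by apply/seteqP; split=> t /=; rewrite andbT.
Qed.

End far_clusters.

Lemma probability_exists_gt0 {R : realType} {dW : measure_display}
    {W : measurableType dW} (P : probability W R) {J : countType} (A : J -> set W) :
  (forall j, measurable (A j)) -> (0 < P [set w | exists j, A j w])%E ->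
  exists j, (0 < P (A j))%E.
Proof.
move=> mA PA; apply: contrapT => /forallNP nA.
have A0 j : P (A j) = 0%E.
  by apply/eqP; rewrite eq_le measure_ge0 andbT leNgt; apply/negP; exact: nA.
suff : P [set w | exists j, A j w] = 0%E by move=> P0; move: PA; rewrite P0 ltxx.
apply: measure_negligible; first exact: measurable_exists.
pose F n : set W := if unpickle n is Some j then A j else set0.
have : P.-negligible (\bigcup_n F n).
  apply: negligible_bigcup => n; rewrite /F; case: unpickle => [j|]; last exact: negligible_set0.
  by apply/negligibleP; [exact: mA|exact: A0].
apply: negligibleS => w [j Aj]; exists (pickle j) => //.
by rewrite /F pickleK.
Qed.

Section small_values.
Context {R : realType} {dW : measure_display} {W : measurableType dW}.
Variable P : probability W R.

Lemma measurable_small (U : W -> R) (delta : R) : measurable_fun setT U ->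
  measurable [set w | 0 < U w < delta].
Proof.
move=> mU; rewrite [X in measurable X](_ : _ = U @^-1` `]0, delta[).
  exact: measurable_preimageT mU _.
by apply/seteqP; split=> w; rewrite /= in_itv.
Qed.

(** The events [0 < U < 1/(n+1)] decrease to the empty set, so continuity from above applies. The
    value 0 is left out, as empty sites may have large probability. *)
Lemma probability_small_le (U : W -> R) (eps : R) : measurable_fun setT U ->
  0 < eps -> exists2 delta, 0 < delta & (P [set w | (0 < U w < delta)%R] <= eps%:E)%E.
Proof.
move=> mU eps0; pose D n := [set w | 0 < U w < n.+1%:R^-1].
have D0 : \bigcap_n D n = set0.
  apply/seteqP; split=> // w Dw.
  have U0 : 0 < U w by have /andP[] := Dw 0%N Logic.I.
  have := archi_boundP (ltW (_ : 0 < (U w)^-1)); rewrite invr_gt0 => /(_ U0).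
  set n := Num.bound _ => Un; have /andP[_] := Dw n Logic.I; apply/negP; rewrite -leNgt.
  rewrite -[leRHS]invrK lef_pV2 ?posrE ?invr_gt0//.
  by apply: ltW; apply: lt_trans Un _; rewrite ltr_nat.
have mD n : measurable (D n) by exact: measurable_small.
have /fine_cvgP[_] : (P \o D) @ \oo --> 0%E.
  rewrite -(measure0 P) -D0; apply: nonincreasing_cvg_mu => //.
  - by rewrite -ge0_fin_numE// fin_num_measure.
  - by rewrite D0.
  - apply/nonincreasing_seqP => n; apply/subsetPset => w /andP[U0 Un].
    by rewrite /D /= U0 (lt_le_trans Un)// lef_pV2 ?posrE// ler_nat.
move=> /cvgr_lt/(_ eps eps0)[n _ /(_ n (leqnn n))/= Pn].
exists n.+1%:R^-1; first by rewrite invr_gt0.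
by rewrite -(fineK (fin_num_measure P _ (mD n))) lee_fin ltW.
Qed.

Lemma probability_small_seq {J : eqType} (l : seq J) (U : J -> W -> R) (eps : R) :
  (forall j, measurable_fun setT (U j)) -> 0 < eps -> exists2 delta, 0 < delta &
    forall j, j \in l -> (P [set w | (0 < U j w < delta)%R] <= eps%:E)%E.
Proof.
move=> mU eps0; elim: l => [|j l [delta delta0 IH]]; first by exists 1.
have [delta' delta'0 Pj] := probability_small_le (mU j) eps0.
exists (Num.min delta delta'); first by rewrite lt_min delta0.
move=> i; rewrite inE => /predU1P[->|il].
  apply: le_trans Pj; apply: le_measure; rewrite ?inE; [exact: measurable_small..|].
  by move=> w /= /andP[->]; rewrite lt_min => /andP[].
apply: le_trans (IH _ il); apply: le_measure; rewrite ?inE; [exact: measurable_small..|].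
by move=> w /= /andP[->]; rewrite lt_min => /andP[].
Qed.

End small_values.

(** * Stationarity of the good field *)

Section field_percolation.
Context {R : realType} {d : nat} {M : R} {N : nat}.
Context {dS : measure_display} {S : measurableType dS}.
Variable E : @environment R d M N dS S.
Context {dW : measure_display} {W : measurableType dW}.
Variables (P : probability W R) (Y : Zlat d -> W -> S).
Variables (lam : R) (V : Zlat d -> nat -> W -> R * R).
Hypotheses (hN : (0 < N)%N) (hY : iid P Y) (hV : poisson_family P Y lam V).
Variable delta : R.
Hypothesis hdelta : 0 <= delta.

Lemma config_bits_independent :
  independent P (sigma_of (config_of Y)) (sigma_of (config_of (bits V delta))).
Proof.
pose F := noise Y V.
have subY : sigma_of (config_of Y) `<=` <<s \bigcup_(i in range inl) F i >>.
  move=> A /sigma_of_config; apply: smallest_sub; first exact: smallest_sigma_algebra.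
  by move=> B [z _ zB]; apply: sub_gen_smallest; exists (inl z) => //; exists z.
have subV : sigma_of (config_of (bits V delta)) `<=` <<s \bigcup_(i in range inr) F i >>.
  move=> A /sigma_of_config; apply: smallest_sub; first exact: smallest_sigma_algebra.
  move=> B [z _ zB]; apply: sub_gen_smallest; exists (inr z); first by exists z.
  exact: sigma_process_point_bit (measurable_slab delta) _ zB.
move=> A B /subY sA /subV sB; apply: independent_groups sA sB.
- exact: noise_setI.
- exact: noise_setT.
- exact: noise_measurable hY hV.
- exact: noise_independent hY hV.
- by apply/seteqP; split=> // i [[z _ <-] [k _]].
Qed.

Lemma field_event_shift (A : set (config d S * config d bool)) v : measurable A ->
  P [set w | A (shift_config v (config_of Y w),
                shift_config (v *+ N) (config_of (bits V delta) w))] =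
  P [set w | A (config_of Y w, config_of (bits V delta) w)].
Proof.
move=> mA; apply: joint_shift_law => //; first exact: (bits_iid hY hV hdelta).
exact: config_bits_independent.
Qed.

Lemma field_law z :
  P [set w | good_field E Y V delta z w] = P [set w | good_field E Y V delta 0 w].
Proof.
rewrite -(field_event_shift z (measurable_good_pair E hN delta 0)).
congr (P _); apply/seteqP; split=> w /=;
  by rewrite (good_pair_shift E hN delta (config_of Y w, config_of (bits V delta) w)) add0r.
Qed.

Lemma far_cluster_origin :
  percolates P (good_field E Y V delta) ->
  (0 < P [set w | far_cluster (good_field E Y V delta ^~ w) 0])%E.
Proof.
move=> perc.
have mf z : measurable [set w | good_field E Y V delta z w].
  have /(_ measurableT [set true] Logic.I) := measurable_field E hN hY hV hdelta z.
  by rewrite setTI.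
have : (0 < P [set w | exists u, [set w | far_cluster (good_field E Y V delta ^~ w) u] w])%E.
  move: perc; rewrite /percolates; congr (_ < P _)%E.
  by apply/seteqP; split=> w [u uw]; exists u; move: uw => /infinite_clusterP.
move=> /probability_exists_gt0[u|u].
  exact: measurable_far_cluster.
pose A : set (config d S * config d bool) := [set x | far_cluster (good_pair E delta x) 0].
have mA : measurable A.
  apply: measurable_far_cluster => z; exact: measurable_good_pair.
rewrite [X in (_ < X)%E -> _](_ : _ = P [set w | A (config_of Y w, config_of (bits V delta) w)])//.
rewrite -(field_event_shift u mA); congr (P _); apply/seteqP; split=> w /=.
  move=> /far_cluster_shift; rewrite /A /=.
  congr (far_cluster _ _); apply/funext => z.
  by rewrite (good_pair_shift E hN delta (config_of Y w, config_of (bits V delta) w)).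
move=> h; apply/far_cluster_shift; move: h; rewrite /A /=.
congr (far_cluster _ _); apply/funext => z.
by rewrite (good_pair_shift E hN delta (config_of Y w, config_of (bits V delta) w)).
Qed.

End field_percolation.

(** * The marginal of the good field *)

Section marginals.
Context {R : realType} {d : nat} {M : R} {N : nat}.
Context {dS : measure_display} {S : measurableType dS}.
Variable E : @environment R d M N dS S.
Context {dW : measure_display} {W : measurableType dW}.
Variables (P : probability W R) (Y : Zlat d -> W -> S).
Variables (V : R -> Zlat d -> nat -> W -> R * R).
Hypotheses (hN : (0 < N)%N) (hY : iid P Y)
  (hV : forall lam, 0 < lam -> poisson_family P Y lam (V lam)).

Lemma measurable_nonempty_cell z :
  measurable [set w | nonempty_cell E (config_of Y w) z].
Proof.
have mY z' : measurable_fun setT (Y z') by case: hY => + _ _; exact.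
rewrite [X in measurable X](_ : _ = [set w | exists k,
    [set w | @Ib R d N z k /\ 0 < env_U E k (config_of Y w)] w]); last first.
  by apply/seteqP; split=> w [k]; [move=> ? ?; exists k|move=> [? ?]; exists k].
apply: measurable_exists => k; have [zk|nzk] := pselect (@Ib R d N z k); last first.
  by rewrite [X in measurable X](_ : _ = set0)//; apply/seteqP; split=> t // [].
rewrite [X in measurable X](_ : _ = [set w | 0 < env_U E k (config_of Y w)]); last first.
  by apply/seteqP; split=> t //= [].
have /(_ measurableT [set true] Logic.I) :=
  measurable_fun_ltr (measurable_cst (0 : R)) (measurable_env_U E mY k).
by rewrite setTI.
Qed.

Lemma probability_no_bit (lam delta : R) k : 0 < lam -> 0 <= delta ->
  P [set w | ~~ bits (V lam) delta k w] = (expR (- (lam * delta)))%:E.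
Proof.
move=> lam0 delta0; have vol := slab_volume delta0.
have := bits_iid hY (hV lam0) delta0 => -[mb _ _].
have -> : [set w | ~~ bits (V lam) delta k w] = ~` [set w | bits (V lam) delta k w].
  by apply/seteqP; split=> w /negP.
have mbk : measurable [set w | bits (V lam) delta k w].
  by have := mb k measurableT [set true] Logic.I; rewrite setTI.
rewrite (probability_setC _ mbk) (probability_point_bit (hV lam0));
  [|exact: measurable_slab|exact: slab_strip|by rewrite vol ltry].
by rewrite vol /= -EFinB opprB addrC subrK.
Qed.

Lemma field_marginal (q0 : R) : coverage E P Y q0 -> exists delta lam,
  [/\ 0 < delta, 0 < lam &
      forall z, (q0%:E <= P [set w | good_field E Y (V lam) delta z w])%E].
Proof.
have mY z' : measurable_fun setT (Y z') by case: hY => + _ _; exact.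
rewrite /coverage; set A := [set w | nonempty_cell _ _ _].
have mA : measurable A by exact: measurable_nonempty_cell.
rewrite -(fineK (fin_num_measure P _ mA)) lte_fin; set a := fine _ => qa.
pose l := ball_seq (3 * N) (0 : Zlat d).
(* Each site of [l] costs [2 * eps], one [eps] for a small U and one for a missing point; together
   they do not exceed the gap [a - q0]. *)
pose eps := (a - q0) / (2 * (size l).+1%:R).
have eps0 : 0 < eps by rewrite divr_gt0 ?subr_gt0// mulr_gt0.
have [delta delta0 small] := probability_small_seq P l
  (fun k => measurable_env_U E mY k) eps0.
(* Chosen so that exp(-lam delta) = exp(-1/eps) <= eps. *)
pose lam := (delta * eps)^-1.
have lam0 : 0 < lam by rewrite invr_gt0 mulr_gt0.
exists delta, lam; split => // z; rewrite (field_law E hN hY (hV lam0) (ltW delta0)).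
pose Bad k := [set w | 0 < env_U E k (config_of Y w) < delta] `|`
              [set w | ~~ bits (V lam) delta k w].
have mbit k : measurable [set w | ~~ bits (V lam) delta k w].
  have [mb _ _] := bits_iid hY (hV lam0) (ltW delta0).
  by have := mb k measurableT [set false] Logic.I; rewrite setTI; congr measurable;
    apply/seteqP; split=> w /=; case: bits.
have mBad k : measurable (Bad k).
  by apply: measurableU => //; exact: measurable_small (measurable_env_U E mY k).
have exp_le : expR (- (lam * delta)) <= eps.
  have -> : lam * delta = eps^-1.
    by rewrite /lam invfM mulrAC mulVf ?mul1r// gt_eqF.
  rewrite expRN -[leRHS]invrK lef_pV2 ?posrE ?expR_gt0 ?invr_gt0//.
  by have := expR_ge1Dx eps^-1; lra.
have Bad_le k : k \in l -> (P (Bad k) <= (2 * eps)%:E)%E.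
  move=> kl; apply: le_trans (measureU2 P _ _) _ => //.
    exact: measurable_small (measurable_env_U E mY k).
  have -> : 2 * eps = eps + eps by ring.
  rewrite EFinD; apply: leeD; first exact: small.
  by rewrite [leLHS](probability_no_bit k lam0 (ltW delta0)) lee_fin.
have mF : measurable [set w | good_field E Y (V lam) delta 0 w].
  have /(_ measurableT [set true] Logic.I) := measurable_field E hN hY (hV lam0) (ltW delta0) 0.
  by rewrite setTI.
have mBads : measurable [set w | exists2 k, k \in l & Bad k w].
  exact: measurable_in_seq.
have sub : A `<=` [set w | good_field E Y (V lam) delta 0 w] `|`
    [set w | exists2 k, k \in l & Bad k w].
  move=> w Aw; have [bad|nbad] := pselect (exists2 k, k \in l & Bad k w); first by right.
  left; apply/asboolP; split => // k /(Ib2_finite hN) kl Uk.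
  split.
    by rewrite leNgt; apply/negP => Ukd; apply: nbad; exists k => //; left; rewrite /= Uk.
  by apply/negPn/negP => nb; apply: nbad; exists k => //; right.
have PA : (P A <= P [set w | good_field E Y (V lam) delta 0 w] + ((size l)%:R * (2 * eps))%:E)%E.
  apply: le_trans (le_measure P _ _ sub) _; rewrite ?inE//; first exact: measurableU.
  apply: le_trans (measureU2 P mF mBads) _.
  by apply: leeD => //; exact: probability_union_bound.
have le_gap : (size l)%:R * (2 * eps) <= a - q0.
  have <- : (size l).+1%:R * (2 * eps) = a - q0.
    by rewrite mulrA mulrC mulrA -mulrA [_.+1%:R * _]mulrC divfK ?mulf_neq0 ?pnatr_eq0.
  by rewrite ler_wpM2r ?ler_nat// mulr_ge0// ltW.
move: PA; rewrite -(fineK (fin_num_measure P _ mA)) -/a -(fineK (fin_num_measure P _ mF)).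
by rewrite -EFinD !lee_fin; lra.
Qed.

End marginals.

(** * The upper bound: from good cells to crossings *)

Section far_cluster_crossing.
Context {R : realType} {d : nat} {M : R} {N : nat}.
Context {dS : measure_display} {S : measurableType dS}.
Variable E : @environment R d M N dS S.
Variables (Gamma : euclid R d -> R) (Gamma_inv : R -> euclid R d).
Hypothesis hGamma : bimeasurable_bijection (cube M N : set (euclid R d))
  (`[0, 1] : set R) Gamma Gamma_inv.
Context {dW : measure_display} {W : measurableType dW}.
Variables (P : probability W R) (Y : Zlat d -> W -> S).
Variables (lam : R) (V : R -> Zlat d -> nat -> W -> R * R).
Hypotheses (hM : 1 <= M) (hNM : 2 * d%:R * M < N%:R) (hN : (0 < N)%N).
Hypotheses (hV : poisson_family P Y lam (V lam)).
Variables (delta eta : R) (w : W).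
Hypotheses (heta : 0 < eta).
Hypothesis hconn : forall z k k', @Ib1 R d N z k -> @Ib1 R d N z k' ->
  nonempty_site E (config_of Y w) k -> nonempty_site E (config_of Y w) k' ->
  supported_chain E eta (config_of Y w) (@Ib2 R d N z) k k'.

Let V_strip k i w' : strip (V lam k i w').
Proof. exact: pp_strip (pf_process hV k) i w'. Qed.

Let pt k i := cox_point E Gamma Gamma_inv Y (V lam) k i w.
Let active k i := cox_active E Y (V lam) k i w.
Let X := cox_points E Gamma Gamma_inv (config_of Y w) (fun k i => V lam k i w).
Let U k := env_U E k (config_of Y w).

Let XE : X = [set p | exists2 j : Zlat d * nat, active j.1 j.2 & p = pt j.1 j.2].
Proof. exact: cox_pointsE. Qed.

Let pt_X k i : active k i -> X (pt k i).
Proof. by move=> ki; rewrite XE; exists (k, i). Qed.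

Let pt_cell k i : cell M N k (pt k i).
Proof. exact: cox_point_cell. Qed.

(** Coordinates of the two points differ by at most 2 M b, one M b for the sites and one for the
    positions in the cells, so their distance is at most 2 d M / N < 1. A bound on the norm, rather
    than adjacency, also covers two points of one site. *)
Lemma near_sites_joined k k' i i' : `|site N k - site N k' : 'rV[R]_d| <= mesh N ->
  active k i -> active k' i' -> joined (covered X) (pt k i) (pt k' i').
Proof.
move=> kk' ki ki'; apply: joined_centers; [exact: pt_X..|].
have m0 : 0 <= mesh N :> R by rewrite invr_ge0.
have Mm0 : 0 <= M * mesh N by rewrite mulr_ge0// (le_trans ler01 hM).
apply: (@le_lt_trans _ _ (d%:R * (2 * (M * mesh N)))).
  apply: euclid_dist_le; first by rewrite mulr_ge0.
  move=> j; have := cellP (pt_cell k i) j; have := cellP (pt_cell k' i') j.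
  have sE : (site N k - site N k' : 'rV[R]_d) ord0 j =
      mesh N * ((k ord0 j)%:~R - (k' ord0 j)%:~R).
    by rewrite !mxE mulrBr.
  have dk : `|(site N k - site N k' : 'rV[R]_d) ord0 j| <= mesh N.
    by have [+ _] := mx_norm_le (site N k - site N k') m0; apply.
  have key (m b x y p q : R) : 0 <= m -> `|b * (x - y)| <= b ->
      0 <= q - m * b * y <= m * b -> 0 <= p - m * b * x <= m * b ->
      `|p - q| <= 2 * (m * b).
    move=> m_ge0 bxy qy px; have h : `|m * b * x - m * b * y| <= m * b.
      rewrite -mulrBr -mulrA normrM (ger0_norm m_ge0).
      by rewrite ler_wpM2l.
    move: (m * b * x) (m * b * y) (m * b) qy px h => X' Y' Z' qy px.
    by rewrite !ler_norml; lra.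
  rewrite sE in dk.
  exact: (key _ _ _ _ _ _ (le_trans ler01 hM) dk).
have N0 : 0 < N%:R :> R by rewrite ltr0n.
rewrite mulrCA !mulrA ltr_pdivrMr// mul1r.
exact: hNM.
Qed.

Lemma chain_joined n (c : nat -> Zlat d) i i' :
  (forall j, (j < n)%N -> @Defs.adjacent R d N (c j) (c j.+1)) ->
  (forall j, (j <= n)%N -> exists l, active (c j) l) ->
  active (c 0) i -> active (c n) i' -> joined (covered X) (pt (c 0) i) (pt (c n) i').
Proof.
elim: n i' => [|n IH] i' cadj cact ci ci'.
  by apply: near_sites_joined => //; rewrite subrr normr0 invr_ge0.
have [l cl] := cact n (leqnSn n).
apply: (@joined_trans _ _ _ _ (pt (c n) l)).
  by apply: IH => // j jn; [apply: cadj|apply: cact]; exact: leqW.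
by apply: near_sites_joined => //; rewrite cadj.
Qed.

Let f := good_field E Y (V lam) delta ^~ w.

Lemma field_active z k : f z -> @Ib2 R d N z k -> 0 < U k -> exists i, active k i.
Proof.
move=> /asboolP[_ h] zk Uk; have [dU /point_bitP[i [_ Vi]]] := h k zk Uk.
exists i; apply: le_trans dU.
by move: Vi; rewrite /= in_itv /= => /andP[].
Qed.

Lemma nearest_neighbour_linf (z u : Zlat d) : nearest_neighbour z u -> (linf_dist z u <= 1)%N.
Proof.
move=> /eqP zu; apply/linf_dist_le => i.
by rewrite -[leqRHS]zu (bigD1 i)//= leq_addr.
Qed.

(** Both sites lie in [Ib1 z], so the chain between them stays in [Ib2 z]; all its sites being
    non-empty, the goodness of [z] alone provides a kept point at each. *)
Lemma step_joined z u k k' i i' : f z -> nearest_neighbour z u ->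
  @Ib R d N z k -> @Ib R d N u k' -> 0 < U k -> 0 < U k' ->
  active k i -> active k' i' -> joined (covered X) (pt k i) (pt k' i').
Proof.
move=> fz zu zk uk' Uk Uk' ki ki'.
have zk1 : @Ib1 R d N z k by apply: (Ib_Ib1 hN) zk; apply/linf_dist_le => j; rewrite distnn.
have zk1' : @Ib1 R d N z k' by apply: (Ib_Ib1 hN) uk'; exact: nearest_neighbour_linf.
have [n [c [c0 cn cD cadj csup]]] := hconn zk1 zk1' Uk Uk'.
rewrite -c0 -cn in ki ki' *; apply: chain_joined => // j jn.
apply: (field_active fz); first exact: cD.
(* The ends are non-empty by assumption, the inner links because [0 < eta]. *)
have [->|j0] := posnP j; first by rewrite c0.
move: jn; rewrite leq_eqVlt => /predU1P[->|jn]; first by rewrite cn.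
by apply: lt_le_trans heta _; apply: csup; rewrite j0.
Qed.

Lemma walk_joined z s k i : all f (z :: s) -> path nearest_neighbour z s ->
  @Ib R d N z k -> 0 < U k -> active k i -> exists k' i',
  [/\ @Ib R d N (last z s) k', active k' i' & joined (covered X) (pt k i) (pt k' i')].
Proof.
elim: s z k i => [|u s IH] z k i /=.
  move=> _ _ zk Uk ki; exists k, i; split => //.
  by apply: near_sites_joined => //; rewrite subrr normr0 invr_ge0.
move=> /andP[fz fus] /andP[zu us] zk Uk ki.
have /asboolP[[k1 uk1 Uk1] _] : f u by have /andP[] := fus.
have [i1 ki1] : exists i, active k1 i.
  by apply: (@field_active u) => //; [case/andP: fus|exact: (Ib_Ib2 hN)].
have [k' [i' [lk' ki' kk']]] := IH u k1 i1 fus us uk1 Uk1 ki1.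
exists k', i'; split; [exact: lk'|exact: ki'|].
exact: (joined_trans (step_joined fz zu zk uk1 Uk Uk1 ki ki1) kk').
Qed.

Lemma far_cluster_crossing n : 4 * M <= n%:R -> far_cluster f 0 ->
  crossing E Gamma Gamma_inv Y lam V n w.
Proof.
move=> nM far.
have hM1 := hM.
have N0 : 0 < N%:R :> R by rewrite ltr0n.
have m0 : 0 < mesh N :> R by rewrite invr_gt0.
have mN : mesh N * N%:R = 1 :> R by rewrite mulVf// gt_eqF.
have mM : M * mesh N <= M.
  rewrite -[leRHS]mulr1 ler_wpM2l//; first by lra.
  by rewrite invf_le1// ler1n.
(* A site of the cell [z] is in z + [0, 1)^d, so its points lie in M z + [0, M + M b]^d, and M b <=
   M. *)
have cell_pos z k i j : @Ib R d N z k ->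
    M * (z ord0 j)%:~R <= (pt k i : 'rV[R]_d) ord0 j <= M * (z ord0 j)%:~R + 2 * M.
  move=> /(IbP hN)/(_ j) => /andP[zk1 zk2]; have := cellP (pt_cell k i) j.
  have zk1R : (z ord0 j)%:~R * N%:R <= (k ord0 j)%:~R :> R.
    by move: zk1; rewrite -(ler_int R) rmorphM.
  have zk2R : (k ord0 j)%:~R <= ((z ord0 j)%:~R + 1) * N%:R :> R.
    by move/ltW: zk2; rewrite -(ler_int R) rmorphM rmorphD.
  have key (x y b n' m p : R) : 0 < m -> 0 < b -> b * n' = 1 -> m * b <= m ->
      x * n' <= y -> y <= (x + 1) * n' -> 0 <= p - m * b * y <= m * b ->
      m * x <= p <= m * x + 2 * m.
    move=> m_gt0 b_gt0 bn mb xy yx py.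
    have h1 : m * b * (x * n') <= m * b * y by rewrite ler_pM2l// mulr_gt0.
    have h2 : m * b * y <= m * b * ((x + 1) * n') by rewrite ler_pM2l// mulr_gt0.
    have e1 : m * b * (x * n') = m * x by rewrite -[RHS]mulr1 -bn; ring.
    have e2 : m * b * ((x + 1) * n') = m * x + m by rewrite -[RHS]mulr1 -[X in _ = _ * X]bn; ring.
    rewrite e1 in h1; rewrite e2 in h2.
    by move: (m * b * y) (m * x) (m * b) h1 h2 mb py => A B C; lra.
  exact: (key _ _ _ _ _ _ (lt_le_trans ltr01 hM) m0 mN mM zk1R zk2R).
(* As M >= 1, a cell at distance more than [n] already lies beyond the radius n - 2M; [n.+3] leaves
   room. *)
have [s /and3P[fs ss ns]] := far n.+3.
have /asboolP[[k zk Uk] _] : f 0 by have /andP[] := fs.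
have [i ki] : exists i, active k i.
  by apply: (@field_active 0) => //; [case/andP: fs|exact: (Ib_Ib2 hN)].
have [k' [i' [lk' ki' kk']]] := walk_joined fs ss zk Uk ki.
(* The end of the walk is only known to lie outside the radius n - 2M; the path is cut back to the
   shell. *)
apply: (@connected_box_shell _ _ _ _ (box (3 * M)) [set x | n%:R - 2 * M < `|x|]);
  [lra|lra| | |].
- have M3 : 0 <= 3 * M by lra.
  by move=> a /(boxP _ M3); lra.
- by [].
apply: joined_connected kk'.
  by move=> j; have := cell_pos 0 k i j zk; rewrite mxE mulr0; lra.
rewrite /= ltNge; apply/negP => /mx_norm_le le_pt.
move: ns; rewrite ltnNge => /negP; apply; apply/linf_dist_le => j.
have nM0 : 0 <= n%:R - 2 * M by lra.
have pz := cell_pos (last 0 s) k' i' j lk'.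
have := le_pt nM0 j; rewrite ler_norml => pn.
rewrite [(0 : Zlat d) ord0 j]mxE sub0r (@absz_leP R) rmorphN normrN /=.
have : `|M * ((last 0 s : Zlat d) ord0 j)%:~R| <= n%:R by rewrite ler_norml; move: pn pz; lra.
rewrite normrM ger0_norm; last by lra.
move=> Mz; apply: (@le_trans _ _ n%:R); last by rewrite ler_nat !leqW.
by apply: le_trans Mz; apply: ler_peMl; [exact: normr_ge0|exact: hM].
Qed.

End far_cluster_crossing.

Theorem proposition5 (R : realType) (d : nat) (hd : (1 <= d)%N)
  (M : R) (hM : 1 <= M) (N : nat) (hN : 2 * d%:R * M < N%:R)
  (q0 : R) (hq0 : 0 <= q0 <= 1) (hq0_perc : dependent_percolation_bound d 6 q0)
  (dS : measure_display) (S : measurableType dS)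
  (E : @environment R d M N dS S)
  (dW : measure_display) (W : measurableType dW) (P : probability W R)
  (Y : Zlat d -> W -> S) (hY : iid P Y)
  (h1dep : one_dependent E)
  (hbounded : bounded_local_intensity E)
  (hcoverage : coverage E P Y q0)
  (hconnected : essentially_connected E P Y)
  (Gamma : euclid R d -> R) (Gamma_inv : R -> euclid R d)
  (hGamma : bimeasurable_bijection (cube M N : set (euclid R d)) (`[0, 1] : set R)
    Gamma Gamma_inv)
  (V : R -> Zlat d -> nat -> W -> R * R)
  (hV : forall lam : R, 0 < lam -> poisson_family P Y lam (V lam)) :
  (0 < lambda_c E P Y Gamma Gamma_inv V < +oo)%E.
Proof.
have N0 : (0 < N)%N.
  by rewrite -(ltr_nat R); apply: le_lt_trans hN; rewrite !mulr_ge0//; lra.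
apply/andP; split.
  have [rho rho0 Urho] := hbounded.
  (* The successor makes [D] positive; [lam0] is the intensity at which lam rho D = 1/2. *)
  pose D : R := (size (@box_seq d N.+1)).+1%:R.
  have D0 : 0 < D by rewrite ltr0n.
  pose lam0 := (2 * (rho * D))^-1.
  have lam0_gt0 : 0 < lam0 by rewrite invr_gt0 !mulr_gt0.
  apply: (@lt_le_trans _ _ lam0%:E); first by rewrite lte_fin.
  apply: le_ereal_inf_tmp => _ [lam [lam_gt0 theta_gt0] <-].
  rewrite lee_fin leNgt; apply/negP => lam_lt; move: theta_gt0; apply/negP.
  rewrite -leNgt; apply: (theta_le0 hGamma hM N0 hY (hV _ lam_gt0) Urho) => //.
  rewrite -/D -mulrA -ler_pdivlMr ?mulr_gt0//.
  by apply: le_trans (ltW lam_lt) _; rewrite /lam0 invfM div1r.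
have [delta [lam [delta0 lam0 marg]]] := field_marginal N0 hY hV hcoverage.
apply: (@le_lt_trans _ _ lam%:E); last exact: ltry.
apply: ereal_inf_lbound; exists lam => //; split => //.
have perc : percolates P (good_field E Y (V lam) delta).
  apply: hq0_perc marg.
    exact: (measurable_field E N0 hY (hV _ lam0) (ltW delta0)).
  exact: (field_finitely_dependent N0 hY (hV _ lam0) h1dep).
have far := far_cluster_origin N0 hY (hV _ lam0) (ltW delta0) perc.
set F := [set w | _] in far.
have mF : measurable F.
  apply: measurable_far_cluster => z.
  have /(_ measurableT [set true] Logic.I) := measurable_field E N0 hY (hV _ lam0) (ltW delta0) z.
  by rewrite setTI.
(* [F] does not depend on n, so it is enough that, up to a null set, it lies in every crossing event
   with n large. *)
apply: lt_le_trans far _; rewrite thetaE; apply: lime_ge.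
  exact: (crossing_cvg (E := E) hGamma hM hY (hV _ lam0)).
have [eta eta0 [A [mA A0 hA]]] := hconnected.
exists (Num.bound (4 * M)) => // n /= nM.
have nM4 : 4 * M <= n%:R.
  apply: le_trans (_ : (Num.bound (4 * M))%:R <= _); last by rewrite ler_nat.
  by apply/ltW/archi_boundP; lra.
have mC := measurable_crossing E hGamma hY (hV _ lam0) n.
(* Essential connectedness holds off a measurable null set [A], which is removed before the events
   are compared. *)
have -> : P F = P (F `\` A).
  rewrite measureD//; last by rewrite -ge0_fin_numE// fin_num_measure.
  rewrite [X in (_ - X)%E](_ : _ = 0%E) ?sube0//.
  apply/eqP; rewrite eq_le measure_ge0 andbT -A0.
  by apply: le_measure; rewrite ?inE//; exact: measurableI.
apply: le_measure; rewrite ?inE//; first exact: measurableD.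
move=> w [Fw nAw].
apply: (far_cluster_crossing hGamma hM hN N0 (hV _ lam0) eta0 _ nM4 Fw).
move=> z k k' zk zk' k0 k0'; apply: contrapT => nc; apply: nAw.
by apply: hA => /(_ z k k' zk zk' k0 k0').
Qed.
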